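(* Let $r\ge1$ and let $N$ be a nonzero proper ideal of $A$. Let $x\in(\mathbb A_F^{fin})^\times$ with corresponding fractional ideal $J=J(x)\in\mathcal J(A)$, let $(\Lambda,\alpha)\in\mathcal L_N^r$, and let $x(\Lambda,\alpha)=(\Lambda',\alpha')$. Then $\Lambda'=J^{-1}\Lambda$ and $\alpha'$ is the composite $$(N^{-1}/A)^r\xrightarrow{\ \alpha\ }N^{-1}\Lambda/\Lambda\xrightarrow{\ x^{-1}\ }N^{-1}J^{-1}\Lambda/J^{-1}\Lambda.$$
   Context: $F$ is a global function field of prime characteristic; $\infty$ is a fixed place of $F$; $A\subset F$ is the ring of elements regular away from $\infty$; $F_\infty$ is the completion of $F$ at $\infty$ and $\mathbb C_\infty$ is the completion of an algebraic closure of $F_\infty$. $\hat A$ is the profinite completion of $A$, $\mathbb A_F^{fin}$ is the ring of finite adeles of $F$ (away from $\infty$), $K(N)=\ker(\mathrm{GL}_r(\hat A)\to\mathrm{GL}_r(A/N))$. $\mathcal J(A)$ is the group of nonzero fractional ideals of $A$. For $x\in(\mathbb A_F^{fin})^\times$, $J(x)=\prod_{\mathfrak p}\mathfrak p^{v_{\mathfrak p}(x)}=x\hat A\cap F$, so that $x\hat A=J(x)\hat A$. A lattice is a finitely generated $A$-submodule $\Lambda\subset\mathbb C_\infty$ meeting every ball of finite radius in a finite set; $\mathcal L_N^r$ is the set of pairs $(\Lambda,\alpha)$ with $\Lambda$ a lattice of rank $r$ and $\alpha:(N^{-1}/A)^r\to N^{-1}\Lambda/\Lambda$ an $A/N$-isomorphism.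 $\Psi^r\subset\mathbb C_\infty^r$ is the set of row vectors with $F_\infty$-linearly independent entries. There is a bijection $\Theta:\mathrm{GL}_r(F)\backslash(\Psi^r\times\mathrm{GL}_r(\mathbb A_F^{fin})/K(N))\to\mathcal L_N^r$ (actions $f(\psi,g)k=(\psi f^{-1},fgk)$), $[(\psi,g)]\mapsto(\Lambda,\alpha)$ with $\Lambda=\psi(F^r\cap g\hat A^r)$ (column vectors) and $\alpha$ the composite $(N^{-1}/A)^r\cong N^{-1}\hat A^r/\hat A^r\xrightarrow{g}N^{-1}g\hat A^r/g\hat A^r\cong N^{-1}(F^r\cap g\hat A^r)/(F^r\cap g\hat A^r)\xrightarrow{\psi}N^{-1}\Lambda/\Lambda$, unlabelled isomorphisms being induced by inclusions. The action of $(\mathbb A_F^{fin})^\times$ on $\mathcal L_N^r$ is defined through $\Theta$ by $x[(\psi,g)]=[(\psi,gx^{-1})]$ ($x$ as a scalar matrix). The map $x^{-1}$: for a fractional ideal $I$, $x^{-1}:N^{-1}I/I\to N^{-1}J^{-1}I/J^{-1}I$ is the $A/N$-isomorphism obtained from multiplication by $x^{-1}$, $N^{-1}I\hat A/I\hat A\to N^{-1}x^{-1}I\hat A/x^{-1}I\hat A$, under the isomorphisms $N^{-1}I/I\cong N^{-1}I\hat A/I\hat A$ and $N^{-1}J^{-1}I/J^{-1}I\cong N^{-1}x^{-1}I\hat A/x^{-1}I\hat A$ induced by inclusions. For $\Lambda=I_1\psi_1+\dots+I_r\psi_r$ ($I_j$ fractional ideals, $\psi\in\Psi^r$), $x^{-1}:N^{-1}\Lambda/\Lambda\to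 N^{-1}J^{-1}\Lambda/J^{-1}\Lambda$ is the map corresponding to the componentwise maps $x^{-1}:\bigoplus_jN^{-1}I_j/I_j\to\bigoplus_jN^{-1}J^{-1}I_j/J^{-1}I_j$ via $\psi$. *)

(* Defs.v *)
(* Modules, ideals and quotients are handled as classical sets; an element of a
   quotient module is a coset, i.e. a set. A map out of a quotient module that
   goes through the inverse of an isomorphism induced by an inclusion
   M/L -> M'/L' is given by the cosets it takes as values: that inverse sends a
   coset X' of L' to the coset of L formed by the elements of M in X'. *)
From HB Require Import structures.
From mathcomp Require Import all_boot all_order all_algebra all_field.
From mathcomp Require Import mathcomp_extra boolp classical_sets functions.
From mathcomp Require Import cardinality reals.

Set Implicit Arguments.
Unset Strict Implicit.
Unset Printing Implicit Defensive.

Import Order.TTheory GRing.Theory Num.Theory.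

Local Open Scope classical_set_scope.
Local Open Scope ring_scope.

(* A place of a global function field is given by its normalized discrete
   valuation; the value [pval v 0] is a dummy, and carries no meaning. *)
Record place (F : fieldType) := Place {
  pval :> F -> int;
  pval0 : pval 0 = 0;
  pvalM : forall x y, x != 0 -> y != 0 -> pval (x * y) = pval x + pval y;
  pvalD : forall x y, x != 0 -> y != 0 -> x + y != 0 ->
    Num.min (pval x) (pval y) <= pval (x + y);
  pval_norm : exists2 x, x != 0 & pval x = 1 }.

Record absval (R : realType) (K : fieldType) := Absval {
  absv :> K -> R;
  absv_ge0 : forall x, 0 <= absv x;
  absv_eq0 : forall x, absv x = 0 <-> x = 0;
  absvM : forall x y, absv (x * y) = absv x * absv y;
  absvD : forall x y, absv (x + y) <= Num.max (absv x) (absv y) }.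

Section PlaceAbs.
Variables (R : realType) (F : fieldType) (v : place F).

(* The base 2 is immaterial: another base > 1 yields the same topology and the
   same bounded sets, and preserves the comparison of absolute values. *)
Definition place_abs_fun (x : F) : R := if x == 0 then 0 else 2 ^ (- pval v x).

Lemma place_abs_ge0 x : 0 <= place_abs_fun x.
Proof. by rewrite /place_abs_fun; case: ifP => // _; exact: exprz_ge0. Qed.

Lemma place_abs_eq0 x : place_abs_fun x = 0 <-> x = 0.
Proof.
rewrite /place_abs_fun; split=> [|->]; last by rewrite eqxx.
by case: eqP => // _ /eqP; rewrite expfz_eq0 pnatr_eq0 andbF.
Qed.

Lemma place_absM x y :
  place_abs_fun (x * y) = place_abs_fun x * place_abs_fun y.
Proof.
rewrite /place_abs_fun mulf_eq0.
case: (eqVneq x 0) => [|x0] /=; first by rewrite mul0r.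
case: (eqVneq y 0) => [|y0] /=; first by rewrite mulr0.
by rewrite pvalM // opprD expfzDr // pnatr_eq0.
Qed.

Lemma place_absD x y :
  place_abs_fun (x + y) <= Num.max (place_abs_fun x) (place_abs_fun y).
Proof.
have [->|x0] := eqVneq x 0; first by rewrite add0r le_max lexx orbT.
have [->|y0] := eqVneq y 0; first by rewrite addr0 le_max lexx.
have [xy0|xy0] := eqVneq (x + y) 0.
  by rewrite {1}/place_abs_fun xy0 eqxx le_max place_abs_ge0.
rewrite /place_abs_fun (negPf x0) (negPf y0) (negPf xy0) le_max.
have := pvalD v x0 y0 xy0; rewrite ge_min => /orP[] h.
  by rewrite ler_weXz2l ?lerN2 ?ler1n.
by rewrite orbC ler_weXz2l ?lerN2 ?ler1n.
Qed.

Definition place_abs : absval R F :=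
  Absval place_abs_ge0 place_abs_eq0 place_absM place_absD.

End PlaceAbs.

(* A completion is given by its universal characterization, which determines
   it up to unique isomorphism: a complete valued field in which the given one
   is densely and isometrically embedded. *)
Record completion (R : realType) (K : fieldType) (a : absval R K) :=
  Completion {
    cfield :> fieldType;
    cabs : absval R cfield;
    cemb : {rmorphism K -> cfield};
    cabs_emb : forall x, cabs (cemb x) = a x;
    cdense : forall (y : cfield) (e : R), 0 < e ->
      exists x : K, cabs (y - cemb x) < e;
    ccomplete : forall u : nat -> cfield,
      (forall e : R, 0 < e -> exists n0, forall m n, (n0 <= m)%N ->
         (n0 <= n)%N -> cabs (u m - u n) < e) ->
      exists l, forall e : R, 0 < e -> exists n0, forall n, (n0 <= n)%N ->
        cabs (u n - l) < e }.

Record alg_closure (K : fieldType) := AlgClosure {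
  aclosed :> closedFieldType;
  aemb : {rmorphism K -> aclosed};
  aalgebraic : forall y : aclosed, algebraicOver aemb y }.

(* The completions of [F] at all places, an algebraic closure of the one at
   [oo] with its extended absolute value, and the completion of that closure. *)
Record completions (R : realType) (F : fieldType) (oo : place F) :=
  Completions {
    loc : forall v : place F, completion (place_abs R v);
    Fbar : alg_closure (loc oo);
    Fbar_abs : absval R Fbar;
    Fbar_absE : forall y : loc oo, Fbar_abs (aemb Fbar y) = cabs (loc oo) y;
    Cinf : completion Fbar_abs }.

(* Sums and multiples are formed in a [Z]-module [V] on which [F] acts by
   [act]. *)
Section Modules.
Variables (F : fieldType) (V : zmodType) (act : F -> V -> V).

Definition msum (I : set F) (M : set V) : set V :=
  [set z | exists n (a : 'I_n -> F) (m : 'I_n -> V),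
     [/\ forall k, I (a k), forall k, M (m k) & z = \sum_k act (a k) (m k)]].

Definition finitely_generated (A : set F) (M : set V) : Prop :=
  exists n (e : 'I_n -> V),
    M = [set z | exists2 a : 'I_n -> F, forall k, A (a k) &
                   z = \sum_k act (a k) (e k)].

Definition module_rank (A : set F) (M : set V) (r : nat) : Prop :=
  exists e : 'I_r -> V,
    [/\ forall k, M (e k),
        forall a : 'I_r -> F, (forall k, A (a k)) ->
          \sum_k act (a k) (e k) = 0 -> forall k, a k = 0 &
        forall m, M m -> exists (b : F) (a : 'I_r -> F),
          [/\ A b, b != 0, forall k, A (a k) &
              act b m = \sum_k act (a k) (e k)]].

Definition coset (L : set V) (x : V) : set V := [set x + l | l in L].

Definition subquot (M L : set V) :=
  {X : set V | exists2 x, M x & X = coset L x}.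

(* the coset [a X + Y], when [X] and [Y] are cosets of the same submodule *)
Definition lincomb (a : F) (X Y : set V) : set V :=
  [set act a x + y | x in X & y in Y].

End Modules.

Section IdealsOfA.
Variables (F : fieldType) (oo : place F).

Definition regular_ring : set F :=
  [set a | forall v : place F, v <> oo -> 0 <= v a].
Local Notation A := regular_ring.

Definition nonzero_ideal (I : set F) : Prop :=
  [/\ I `<=` A,
      forall a b, I a -> I b -> I (a + b),
      forall a b, A a -> I b -> I (a * b) &
      exists2 a, I a & a != 0].

Definition fractional_ideal (I : set F) : Prop :=
  finitely_generated *%R A I /\ exists2 f, I f & f != 0.

(* As A is a Dedekind domain, this is the inverse in the group of nonzero
   fractional ideals. *)
Definition ideal_inv (I : set F) : set F :=
  [set f | forall a, I a -> A (f * a)].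

Definition fplace := {v : place F | v <> oo}.

End IdealsOfA.

Section LocalProduct.
Variables (R : realType) (F : fieldType) (oo : place F).
Variable K : completions R oo.

(* the full product of the completions at the places other than [oo], of which
   the ring of finite adeles is the subring [adelic] below *)
Definition locprod := forall v : fplace oo, loc K (sval v).

HB.instance Definition _ := gen_eqMixin locprod.
HB.instance Definition _ := gen_choiceMixin locprod.

Let lp0 : locprod := fun=> 0.
Let lp1 : locprod := fun=> 1.
Let lpN (x : locprod) : locprod := fun v => - x v.
Let lpD (x y : locprod) : locprod := fun v => x v + y v.
Let lpM (x y : locprod) : locprod := fun v => x v * y v.

Let lpDA : associative lpD.
Proof.
by move=> x y z; apply: functional_extensionality_dep => v; exact: addrA.
Qed.
Let lpDC : commutative lpD.
Proof.
by move=> x y; apply: functional_extensionality_dep => v; exact: addrC.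
Qed.
Let lp0D : left_id lp0 lpD.
Proof.
by move=> x; apply: functional_extensionality_dep => v; exact: add0r.
Qed.
Let lpND : left_inverse lp0 lpN lpD.
Proof.
by move=> x; apply: functional_extensionality_dep => v; exact: addNr.
Qed.

HB.instance Definition _ :=
  GRing.isZmodule.Build locprod lpDA lpDC lp0D lpND.

Let lpMA : associative lpM.
Proof.
by move=> x y z; apply: functional_extensionality_dep => v; exact: mulrA.
Qed.
Let lpMC : commutative lpM.
Proof.
by move=> x y; apply: functional_extensionality_dep => v; exact: mulrC.
Qed.
Let lp1M : left_id lp1 lpM.
Proof.
by move=> x; apply: functional_extensionality_dep => v; exact: mul1r.
Qed.
Let lpMD : left_distributive lpM lpD.
Proof.
by move=> x y z; apply: functional_extensionality_dep => v; exact: mulrDl.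
Qed.

HB.instance Definition _ :=
  GRing.Zmodule_isComPzRing.Build locprod lpMA lpMC lp1M lpMD.

Lemma locprodME (x y : locprod) v : (x * y) v = x v * y v. Proof. by []. Qed.

Definition diag (f : F) : locprod := fun v => cemb (loc K (sval v)) f.

Definition diag_act (f : F) (x : locprod) : locprod := diag f * x.

Definition adelic : set locprod :=
  [set x | finite_set [set v | ~ (cabs (loc K (sval v)) (x v) <= 1)]].

Lemma adelicM x y : adelic x -> adelic y -> adelic (x * y).
Proof.
move=> hx hy; have := hx; rewrite /adelic /= => hx'.
apply: (sub_finite_set _ (_ : finite_set
  ([set v | ~ (cabs (loc K (sval v)) (x v) <= 1)] `|`
   [set v | ~ (cabs (loc K (sval v)) (y v) <= 1)]))); last first.
  by rewrite finite_setU.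
move=> v /=; rewrite locprodME absvM => h; apply: contrapT => /not_orP[].
move=> /contrapT h1 /contrapT h2; apply: h.
by rewrite mulr_ile1 // absv_ge0.
Qed.

(* An element of the profinite completion lim A/I is represented by a family
   [a I] of elements of A, compatible modulo the nonzero ideals I (these are
   the ideals of finite index). The continuous extension of A -> F_v maps it to
   the limit of the [a I], and this realizes lim A/I inside the product. *)
Definition compatible (a : set F -> F) : Prop :=
  (forall I, nonzero_ideal oo I -> regular_ring oo (a I)) /\
  (forall I J, nonzero_ideal oo I -> nonzero_ideal oo J -> I `<=` J ->
     J (a I - a J)).

Definition tends_to (a : set F -> F) (x : locprod) : Prop :=
  forall (v : fplace oo) (e : R), 0 < e ->
    exists2 I0, nonzero_ideal oo I0 &
      forall I, nonzero_ideal oo I -> I `<=` I0 ->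
        cabs (loc K (sval v)) (x v - diag (a I) v) < e.

Definition Ahat : set locprod :=
  [set x | exists2 a, compatible a & tends_to a x].

(* the kernel of the projection lim A/I -> A/N *)
Definition Ahat_ker (N : set F) : set locprod :=
  [set x | exists2 a, compatible a & tends_to a x /\ N (a N)].

Definition vec_Ahat r : set 'cV[locprod]_r := [set y | forall j, Ahat (y j 0)].

(* GL_r of the finite adeles: as matrices are taken over the full product, the
   inverse has to be required to be adelic too *)
Record adeleGL r := AdeleGL {
  gl : 'M[locprod]_r;
  glV : 'M[locprod]_r;
  glK : gl *m glV = 1%:M;
  glVK : glV *m gl = 1%:M;
  gl_adelic : forall i j, adelic (gl i j);
  glV_adelic : forall i j, adelic (glV i j) }.

Record adele_unit := AdeleUnit {
  au : locprod;
  auV : locprod;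
  auK : au * auV = 1;
  au_adelic : adelic au;
  auV_adelic : adelic auV }.

Lemma auVK (x : adele_unit) : auV x * au x = 1.
Proof. by rewrite mulrC auK. Qed.

Section MulUnit.
Variables (r : nat) (g : adeleGL r) (x : adele_unit).

Let mul_glV : (gl g *m (auV x)%:M) *m ((au x)%:M *m glV g) = 1%:M.
Proof. by rewrite mulmxA -(mulmxA (gl g)) -scalar_mxM auVK mulmx1 glK. Qed.

Let mul_glVK : ((au x)%:M *m glV g) *m (gl g *m (auV x)%:M) = 1%:M.
Proof. by rewrite mulmxA -(mulmxA _%:M) glVK mulmx1 -scalar_mxM auK. Qed.

Let mul_adelic i j : adelic ((gl g *m (auV x)%:M) i j).
Proof.
by rewrite mul_mx_scalar mxE; apply: adelicM;
  [exact: auV_adelic|exact: gl_adelic].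
Qed.

Let mulV_adelic i j : adelic (((au x)%:M *m glV g) i j).
Proof.
by rewrite mul_scalar_mx mxE; apply: adelicM;
  [exact: au_adelic|exact: glV_adelic].
Qed.

Definition gl_mulV : adeleGL r :=
  AdeleGL mul_glV mul_glVK mul_adelic mulV_adelic.

End MulUnit.

(* the congruence subgroup K(N), the kernel of GL_r(Ahat) -> GL_r(A/N) *)
Definition KN (N : set F) r : set (adeleGL r) :=
  [set k | [/\ forall i j, Ahat (gl k i j),
               forall i j, Ahat (glV k i j) &
               forall i j, Ahat_ker N (gl k i j - (1%:M : 'M_r) i j)]].

Definition idealJ (x : adele_unit) : set F :=
  [set f | exists2 y, Ahat y & diag f = au x * y].

End LocalProduct.

Section Lattices.
Variables (R : realType) (F : fieldType) (oo : place F).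
Variable K : completions R oo.
Local Notation A := (regular_ring oo).
Local Notation C := (cfield (Cinf K)).

Definition emb_oo (y : loc K oo) : C := cemb (Cinf K) (aemb (Fbar K) y).
Definition emb (f : F) : C := emb_oo (cemb (loc K oo) f).
Definition Cact (f : F) (z : C) : C := emb f * z.

Definition lattice (L : set C) : Prop :=
  finitely_generated Cact A L /\
  forall (c : C) (b : R),
    finite_set (L `&` [set z | cabs (Cinf K) (z - c) <= b]).

Definition Psi r : set 'rV[C]_r :=
  [set psi | forall c : 'I_r -> loc K oo,
     \sum_j emb_oo (c j) * psi 0 j = 0 -> forall j, c j = 0].

Section LevelN.
Variables (N : set F) (r : nat).
Local Notation Ninv := (ideal_inv oo N).

(* On these modules, which are killed by N, A/N-linear means A-linear. *)
Definition is_level (L : set C)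
    (al : ('I_r -> subquot Ninv A) -> subquot (msum Cact Ninv L) L) : Prop :=
  bijective al /\
  forall a, A a -> forall X Y Z : 'I_r -> subquot Ninv A,
    (forall j, sval (Z j) = lincomb *%R a (sval (X j)) (sval (Y j))) ->
    sval (al Z) = lincomb Cact a (sval (al X)) (sval (al Y)).

Record level_lattice := LevelLattice {
  lat : set C;
  lev : ('I_r -> subquot Ninv A) -> subquot (msum Cact Ninv lat) lat;
  lat_lattice : lattice lat;
  lat_rank : module_rank Cact A lat r;
  lev_level : is_level lev }.

Definition Fr_cap (g : 'M[locprod K]_r) : set 'cV[F]_r :=
  [set w | exists2 y, vec_Ahat y & map_mx (diag K) w = g *m y].

Definition psi_map (psi : 'rV[C]_r) (w : 'cV[F]_r) : C :=
  (psi *m map_mx emb w) 0 0.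

Definition Theta_lat (psi : 'rV[C]_r) (g : 'M[locprod K]_r) : set C :=
  [set psi_map psi w | w in Fr_cap g].

(* The image of a coset X of A^r: multiply by g, take the elements of
   N^-1 (F^r cap g Ahat^r) in the resulting coset of g Ahat^r, apply psi. *)
Definition Theta_lev (psi : 'rV[C]_r) (g : 'M[locprod K]_r)
    (X : 'I_r -> set F) : set C :=
  [set psi_map psi w | w in
     [set w | msum *:%R Ninv (Fr_cap g) w /\
        exists2 v : 'cV[F]_r, forall j, X j (v j 0) &
          exists2 y, vec_Ahat y &
            map_mx (diag K) w - g *m map_mx (diag K) v = g *m y]].

Definition Psi_GL := ({psi : 'rV[C]_r | Psi psi} * adeleGL K r)%type.

(* [dclass s] is the class of s in GL_r(F) \ (Psi x GL_r(adeles) / K(N)), for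
   the actions f (psi, g) k = (psi f^-1, f g k). *)
Definition dequiv (s t : Psi_GL) : Prop :=
  exists (f : 'M[F]_r) (k : adeleGL K r),
    [/\ f \in unitmx, KN N k,
        sval t.1 = sval s.1 *m map_mx emb (invmx f) &
        gl t.2 = map_mx (diag K) f *m gl s.2 *m gl k].

Definition dclass (s : Psi_GL) : set Psi_GL := [set t | dequiv s t].

(* the graph of the bijection Theta *)
Definition Theta (c : set Psi_GL) (L : level_lattice) : Prop :=
  exists s : Psi_GL,
    [/\ c = dclass s,
        lat L = Theta_lat (sval s.1) (gl s.2) &
        forall X, sval (lev L X) =
                  Theta_lev (sval s.1) (gl s.2) (fun j => sval (X j))].

(* the graph of the action of x: it relates L to x L *)
Definition adele_act (x : adele_unit K) (L L' : level_lattice) : Prop :=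
  exists s : Psi_GL,
    Theta (dclass s) L /\ Theta (dclass (s.1, gl_mulV s.2 x)) L'.

End LevelN.

Section MulByInverse.
Variables (N : set F) (x : adele_unit K).
Local Notation Ninv := (ideal_inv oo N).
Local Notation Jinv := (ideal_inv oo (idealJ x)).

(* The map N^-1 I / I -> N^-1 J^-1 I / J^-1 I: multiply a coset X of I by x^-1
   and take the elements of N^-1 J^-1 I in the resulting coset of x^-1 I Ahat. *)
Definition xinv_ideal (I X : set F) : set F :=
  [set w | msum *%R Ninv (msum *%R Jinv I) w /\
     exists2 u, X u &
       exists2 y, msum (@diag_act _ _ _ K) I (@Ahat _ _ _ K) y &
         diag K w - auV x * diag K u = auV x * y].

Variable r : nat.

Definition presentation (L : set C) (I : 'I_r -> set F) (psi : 'rV[C]_r) :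
    Prop :=
  [/\ forall j, fractional_ideal oo (I j), Psi psi &
      L = [set z | exists2 u : 'I_r -> F, forall j, I j (u j) &
                     z = \sum_j Cact (u j) (psi 0 j)]].

(* The map N^-1 L / L -> N^-1 J^-1 L / J^-1 L, for L presented by I and psi;
   X is a coset of L, containing the element with coordinates u. *)
Definition xinv_lattice (I : 'I_r -> set F) (psi : 'rV[C]_r) (X : set C) :
    set C :=
  [set z | exists u w : 'I_r -> F,
     [/\ forall j, msum *%R Ninv (I j) (u j),
         X (\sum_j Cact (u j) (psi 0 j)),
         forall j, xinv_ideal (I j) (coset (I j) (u j)) (w j) &
         z = \sum_j Cact (w j) (psi 0 j)]].

End MulByInverse.

End Lattices.

(* Main.v *)
Require Import Defs.
From HB Require Import structures.
From mathcomp Require Import all_boot all_order all_algebra all_field.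
From mathcomp Require Import boolp classical_sets cardinality reals.
From mathcomp Require Import generic_quotient zify ring lra.

Set Implicit Arguments.
Unset Strict Implicit.
Unset Printing Implicit Defensive.

Import Order.TTheory GRing.Theory Num.Theory.

Local Open Scope classical_set_scope.
Local Open Scope ring_scope.

(** Write [A] for the regular functions away from [oo], and [|f|_v] for the
    absolute value of a place [v] other than [oo].

    Let [(psi, g)] represent [(Lambda, alpha)], so that [(psi, g x^-1)]
    represents its image under [x]. Everything rests on two facts about [A]: its
    profinite completion consists of all the integral adeles, and its nonzero
    ideals are invertible and determined by their valuations. They say that
    [x Ahat] and [J Ahat] agree. Hence
    [F^r cap g x^-1 Ahat^r = J^-1 (F^r cap g Ahat^r)] ([Fr_cap_mulV]), which
    gives the lattice after applying [psi]. For the level structure, take ideals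
    [I_j] and a basis [phi] presenting [Lambda]. Then [phi = psi E] with [E] in
    [GL_r(F)], and passing to the representative [(phi, E^-1 g)] of the same
    class makes [F^r cap g Ahat^r] the direct sum of the [I_j]. By density
    [g Ahat^r] is then the direct sum of the [I_j Ahat] ([hat_coordinates]), and
    multiplication by [x^-1] on cosets of [g Ahat^r] can be read coordinate by
    coordinate ([level_coordinates]). A presentation exists because a module
    between two multiples of [A^r] splits off its coordinates one at a time
    ([module_decomposition]).

    The two facts about [A] come from a counting argument. In a finite extension
    of [F_p(T)], the elements that are sums of [s] digits [b_j a^j], with the
    digits in a fixed finite set, number at most a constant times [Q^s], where
    [Q] depends only on [a]: the degrees of numerators and denominators grow
    linearly in [s]. So more than [Q] digits must produce a coincidence
    ([digit_collision]). Applied to representatives of distinct classes this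
    bounds [A / aA], since base [a] expansions in such digits are unique.
    Applied to polynomials in [f] with coefficients 0 and 1, with a non-unit of
    [A] as base, it yields an algebraic equation for [f] over [A], so that [F]
    is the field of fractions of [A]. A non-unit is available because [N] is a
    proper nonzero ideal.

    Finite quotients make [A] a Dedekind ring. A proper ideal of the finite ring
    [A / aA] has an annihilator ([annihilator]), and [A], being cut out by
    valuations, contains every fraction whose powers have a common denominator;
    together these force [I I^-1 = A] ([invertible_ideal]). Since [A] is defined
    by conditions at the places, invertibility makes membership in an ideal a
    local condition ([local_membership]). Finite quotients also show that a
    place is determined by its center on [A] and that a nonzero element has
    finitely many zeros, and the Chinese remainder theorem follows by taking
    powers modulo [aA] ([strong_approximation]). *)

(** * Counting digit expansions *)

(** This property stands in for the fact that [F] has transcendence degree one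
    over a finite field. *)
Definition digit_collision (F : fieldType) : Prop :=
  forall a : F, exists Q : nat, forall (T : finType) (b : T -> F),
    (Q < #|T|)%N -> exists (s : nat) (u u' : {ffun 'I_s -> T}),
      u != u' /\ \sum_j b (u j) * a ^+ j = \sum_j b (u' j) * a ^+ j.

Lemma expn_dominates (C P M : nat) : (P < M)%N ->
  exists s, (C * P ^ s < M ^ s)%N.
Proof.
case: P => [|P] ltPM; first by exists 1%N; rewrite muln0 expn1.
have bernoulli n : (P.+1 ^ n * (P.+1 + n) <= P.+1 * P.+2 ^ n)%N.
  elim: n => [|n IH]; first by rewrite !expn0 addn0 mul1n muln1.
  rewrite !expnS; nia.
have := bernoulli (C * P.+1)%N; set n := (C * P.+1)%N => hn.
exists n; apply: (@leq_trans (P.+2 ^ n)%N); last first.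
  by case: n {hn} => // n; rewrite leq_exp2r.
have : (0 < P.+1 ^ n)%N by rewrite expn_gt0.
by move: hn; rewrite /n; nia.
Qed.

Section FiniteOverRational.
Variables (p : nat) (F : fieldExtType {fraction {poly 'F_p}}).
Local Notation k := 'F_p.
Local Notation toK := (@FracField.tofrac {poly k}).
Local Notation d := (\dim {:F}).
Local Notation e := (vbasis {:F}).

(** A notion of height with finitely many elements below each bound. *)
Definition bounded (m : nat) (f : F) : Prop :=
  exists c : 'I_d -> {poly k},
    (forall i, (size (c i) <= m)%N) /\ f = \sum_i toK (c i) *: e`_i.

Lemma common_denominator (I : finType) (x : I -> {fraction {poly k}}) :
  exists2 q : {poly k}, q != 0 & forall i, exists c, toK q * x i = toK c.
Proof.
have frac (y : {fraction {poly k}}) :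
    exists2 q : {poly k}, q != 0 & exists c, toK q * y = toK c.
  elim/quotW: y => y; exists \d_y; first exact: denom_ratioP.
  exists \n_y; apply/eqP; rewrite !piE.
  rewrite /FracField.equivf /FracField.mulf /= !numden_Ratio ?mulf_neq0 //.
  all: rewrite ?oner_eq0 ?denom_ratioP //.
  by rewrite mulr1 mul1r.
have [q q0 [c hc]] : exists2 q : I -> {poly k}, (forall i, q i != 0) &
    exists c, forall i, toK (q i) * x i = toK (c i).
  have /choice [qc hqc] : forall i, exists qc : {poly k} * {poly k},
      qc.1 != 0 /\ toK qc.1 * x i = toK qc.2.
    by move=> i; have [q q0 [c hc]] := frac (x i); exists (q, c).
  exists (fun i => (qc i).1) => [i|]; first by case: (hqc i).
  by exists (fun i => (qc i).2) => i; case: (hqc i).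
exists (\prod_i q i); first by apply/prodf_neq0 => i _.
move=> i; exists ((\prod_(j | j != i) q j) * c i).
by rewrite (bigD1 i) //= !tofracM -hc mulrCA mulrA.
Qed.

(** The coordinates of finitely many elements become polynomials of bounded
    degree after a common multiplication by a polynomial. *)
Lemma bounded_common (I : finType) (f : I -> F) :
  exists2 q : {poly k}, q != 0 & exists m, forall i, bounded m (toK q *: f i).
Proof.
have [q q0 hq] := common_denominator (fun ij : I * 'I_d => coord e ij.2 (f ij.1)).
have /choice [c hc] := hq.
exists q => //; exists (\max_ij size (c ij)) => i.
exists (fun j => c (i, j)); split=> [j|]; first exact: (leq_bigmax (i, j)).
rewrite {1}(coord_vbasis (memvf (f i))) scaler_sumr; apply: eq_bigr => j _.
by rewrite scalerA (hc (i, j)).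
Qed.

Lemma boundedD m f g : bounded m f -> bounded m g -> bounded m (f + g).
Proof.
move=> [c [hc ->]] [c' [hc' ->]]; exists (fun i => c i + c' i); split=> [i|].
  by rewrite (leq_trans (size_polyD _ _)) // geq_max hc hc'.
by rewrite -big_split; apply: eq_bigr => i _; rewrite tofracD scalerDl.
Qed.

Lemma bounded_sum m n (f : 'I_n -> F) :
  (forall i, bounded m (f i)) -> bounded m (\sum_i f i).
Proof.
move=> hf; apply: big_ind => [|x y|i _]; [|exact: boundedD|exact: hf].
exists (fun=> 0); split=> [i|]; first by rewrite size_poly0.
by rewrite big1 // => i _; rewrite tofrac0 scale0r.
Qed.

Lemma boundedZ m B (c : {poly k}) f :
  (size c <= B)%N -> bounded m f -> bounded (m + B) (toK c *: f).
Proof.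
move=> hB [a [ha ->]]; exists (fun i => c * a i); split=> [i|].
  rewrite (leq_trans (size_polyMleq _ _)) // addnC.
  by rewrite (leq_trans (leq_pred _)) // leq_add.
by rewrite scaler_sumr; apply: eq_bigr => i _; rewrite tofracM scalerA.
Qed.

(** After clearing the denominators of the matrix of multiplication by [a], each
    product with [a] raises the degrees by at most a constant. Multiplication by
    the cleared denominator alone is included to compare different powers of
    [a]. *)
Lemma bounded_mul (a : F) : exists2 q : {poly k}, q != 0 & exists B,
  forall m f, bounded m f ->
    bounded (m + B) (toK q *: f) /\ bounded (m + B) (toK q *: (f * a)).
Proof.
have [q q0 [m0 hm0]] := bounded_common (fun i : 'I_d => e`_i * a).
exists q => //; exists (maxn m0 (size q)) => m f hf; split.
  by apply: boundedZ => //; rewrite leq_maxr.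
have [c [hc ->]] := hf; rewrite mulr_suml scaler_sumr; apply: bounded_sum => i.
rewrite -scalerAl scalerA mulrC -scalerA addnC.
have [b [hb ->]] : bounded (maxn m0 (size q)) (toK q *: (e`_i * a)).
  by have [b [hb bE]] := hm0 i; exists b; split=> // j; rewrite leq_max hb.
by apply: boundedZ => //; exists b.
Qed.

(** There are at most [p ^ (d * m)] elements whose coordinates have [m]
    coefficients, so that a larger family repeats a value. *)
Lemma bounded_code (m : nat) (T : finType) (f : T -> F) :
  (forall t, bounded m (f t)) -> (#|k| ^ (d * m) < #|T|)%N ->
  exists t t', t != t' /\ f t = f t'.
Proof.
move=> /choice [c hc] lt_card.
pose code t : 'M[k]_(d, m) := \matrix_(i, l) (c t i)`_l.
have : ~ injective code.
  by move=> /leq_card; rewrite card_mx leqNgt lt_card.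
move=> /existsNP[t] /existsNP[t'] /not_implyP[ett' /eqP neq].
exists t, t'; split=> //; have [ct ->] := hc t; have [ct' ->] := hc t'.
apply: eq_bigr => i _; congr (toK _ *: _); apply/polyP => l.
have [ltl|gel] := ltnP l m.
  by have /matrixP/(_ i (Ordinal ltl)) := ett'; rewrite !mxE.
by rewrite !nth_default // (leq_trans _ gel).
Qed.

(** There are [#|T| ^ s] digit strings of length [s], and their values, cleared
    of denominators, have coordinates with [m + s * B] coefficients, where only
    [m] depends on the digits. *)
Lemma fieldExt_digit_collision : digit_collision F.
Proof.
move=> a; have [q q0 [B hB]] := bounded_mul a.
exists (#|k| ^ (d * B))%N => T b ltQ.
have [q' q'0 [m hm]] := bounded_common b.
have [s hs] := expn_dominates (#|k| ^ (d * m)) ltQ.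
have hpow n j f : (j <= n)%N -> bounded m f ->
    bounded (m + n * B) (toK (q ^+ n) *: (f * a ^+ j)).
  move=> + hf; elim: n j => [|n IH] j.
    by rewrite leqn0 => /eqP->; rewrite !expr0 mulr1 scale1r mul0n addn0.
  rewrite mulSn addnCA addnC exprS tofracM -scalerA => lejn.
  case: j lejn => [|j] lejn; first by case: (hB _ _ (IH 0%N (leq0n n))).
  by rewrite exprSr mulrA scalerAl; case: (hB _ _ (IH j lejn)).
pose f (u : {ffun 'I_s -> T}) := toK (q ^+ s * q') *: \sum_j b (u j) * a ^+ j.
have hf u : bounded (m + s * B) (f u).
  rewrite /f scaler_sumr; apply: bounded_sum => j.
  by rewrite tofracM -scalerA scalerAl; apply: hpow => //; exact: ltnW.
have : (#|k| ^ (d * (m + s * B)) < #|{ffun 'I_s -> T}|)%N.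
  rewrite card_ffun; have -> : #|'I_s| = s by rewrite card_ord.
  have expE c D : (c ^ (D * (m + s * B)) = c ^ (D * m) * (c ^ (D * B)) ^ s)%N.
    by rewrite -expnM -expnD; congr (_ ^ _)%N; nia.
  by rewrite expE.
move=> /(bounded_code hf) [u [u' [neq eqf]]].
exists s, u, u'; split=> //; apply: scalerI eqf.
by rewrite tofrac_eq0 mulf_neq0 // expf_neq0.
Qed.

End FiniteOverRational.

(** * Embeddings of F as ring morphisms *)

Section Embeddings.
Variables (R : realType) (F : fieldType) (oo : place F) (K : completions R oo).

Lemma diag_is_zmod_morphism : zmod_morphism (diag K).
Proof. by move=> x y; apply: functional_extensionality_dep => v; exact: rmorphB. Qed.

Lemma diag_is_monoid_morphism : monoid_morphism (diag K).
Proof.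
split; first by apply: functional_extensionality_dep => v; exact: rmorph1.
by move=> x y; apply: functional_extensionality_dep => v; exact: rmorphM.
Qed.

HB.instance Definition _ :=
  GRing.isZmodMorphism.Build F (locprod K) (diag K) diag_is_zmod_morphism.
HB.instance Definition _ :=
  GRing.isMonoidMorphism.Build F (locprod K) (diag K) diag_is_monoid_morphism.

Lemma emb_is_zmod_morphism : zmod_morphism (emb K).
Proof. by move=> x y; rewrite /emb /emb_oo !rmorphB. Qed.

Lemma emb_is_monoid_morphism : monoid_morphism (emb K).
Proof. by split=> [|x y]; rewrite /emb /emb_oo ?rmorph1 ?rmorphM. Qed.

HB.instance Definition _ :=
  GRing.isZmodMorphism.Build F (Cinf K) (emb K) emb_is_zmod_morphism.
HB.instance Definition _ :=
  GRing.isMonoidMorphism.Build F (Cinf K) (emb K) emb_is_monoid_morphism.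

End Embeddings.

(** * Ultrametric absolute values *)

#[local] Arguments absv : simpl never.

Section Absval.
Variables (R : realType) (K : fieldType) (a : absval R K).

Lemma absv0 : a 0 = 0. Proof. exact/absv_eq0. Qed.

Lemma absv_gt0 x : x != 0 -> 0 < a x.
Proof.
by move=> x0; rewrite lt0r absv_ge0 andbT; apply: contra_neq x0 => /absv_eq0.
Qed.

Lemma absv1 : a 1 = 1.
Proof.
have a1 : a 1 != 0 by rewrite gt_eqF // absv_gt0 // oner_eq0.
by apply: (mulfI a1); rewrite -absvM !mulr1.
Qed.

Lemma absvX x n : a (x ^+ n) = a x ^+ n.
Proof. by elim: n => [|n IH]; rewrite ?expr0 ?absv1 // !exprS absvM IH. Qed.

Lemma absvN x : a (- x) = a x.
Proof.
have aN1 : a (-1) = 1.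
  by apply/eqP; rewrite -(@eqrXn2 _ 2) ?absv_ge0 // -absvX sqrrN !expr1n absv1.
by rewrite -mulN1r absvM aN1 mul1r.
Qed.

Lemma absvV x : a x^-1 = (a x)^-1.
Proof.
have [->|x0] := eqVneq x 0; first by rewrite invr0 absv0 invr0.
have ax0 : a x != 0 by rewrite gt_eqF ?absv_gt0.
by apply: (mulfI ax0); rewrite -absvM !divff // absv1.
Qed.

Lemma absvD_le x y b : a x <= b -> a y <= b -> a (x + y) <= b.
Proof. by move=> hx hy; apply: le_trans (absvD a x y) _; rewrite ge_max hx. Qed.

Lemma absvB_le x y b : a x <= b -> a y <= b -> a (x - y) <= b.
Proof. by move=> hx hy; apply: absvD_le => //; rewrite absvN. Qed.

Lemma absvD_lt x y b : a x < b -> a y < b -> a (x + y) < b.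
Proof. by move=> hx hy; apply: le_lt_trans (absvD a x y) _; rewrite gt_max hx. Qed.

Lemma absvB_lt x y b : a x < b -> a y < b -> a (x - y) < b.
Proof. by move=> hx hy; apply: absvD_lt => //; rewrite absvN. Qed.

Lemma absvDl x y : a x < a y -> a (x + y) = a y.
Proof.
move=> lt_xy; apply: le_anti; rewrite absvD_le ?(ltW lt_xy) //=.
rewrite leNgt; apply/negP => lt; have := absvB_lt lt lt_xy.
by rewrite addrAC subrr add0r ltxx.
Qed.

Lemma absv_sum_lt (I : Type) (r : seq I) (P : pred I) (f : I -> K) b : 0 < b ->
  (forall i, P i -> a (f i) < b) -> a (\sum_(i <- r | P i) f i) < b.
Proof.
move=> b0 hf; apply: (big_ind (fun x => a x < b)) => //; first by rewrite absv0.
by move=> x y; exact: absvD_lt.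
Qed.

End Absval.

Lemma le1_of_bounded_powers (R : realType) (x c : R) : 0 < c ->
  (forall n, x ^+ n * c <= 1) -> x <= 1.
Proof.
move=> c0 hx; rewrite leNgt; apply/negP => x1; pose e := x - 1.
have e0 : 0 < e by rewrite /e subr_gt0.
have bernoulli n : 1 + n%:R * e <= x ^+ n.
  elim: n => [|n IH]; first by rewrite mul0r addr0.
  rewrite exprS; have xE : x = 1 + e by rewrite /e; ring.
  have n0 : 0 <= n%:R :> R by [].
  have : 0 <= n%:R * e * e by rewrite !mulr_ge0 // ltW.
  by rewrite -natr1; nra.
have := archi_boundP (ltW (divr_gt0 (@ltr01 R) (mulr_gt0 e0 c0))).
set n := Num.bound _; rewrite ltr_pdivrMr ?mulr_gt0 // => hn.
have := hx n; have := bernoulli n; nra.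
Qed.

(** * Sums of products *)

Section SumsOfProducts.
Variables (F : fieldType) (V : zmodType) (act : F -> V -> V).
Variables (I : set F) (M : set V).

Lemma msum_in a m : I a -> M m -> msum act I M (act a m).
Proof.
move=> Ia Mm; exists 1%N, (fun=> a), (fun=> m); split=> //.
by rewrite big_ord_recl big_ord0 addr0.
Qed.

Lemma msum0 : msum act I M 0.
Proof.
by exists 0%N, (fun=> 0), (fun=> 0); split; [case|case|rewrite big_ord0].
Qed.

Lemma msumD x y : msum act I M x -> msum act I M y -> msum act I M (x + y).
Proof.
move=> [n [a [m [ha hm ->]]]] [n' [a' [m' [ha' hm' ->]]]].
exists (n + n')%N, (fun k => match fintype.split k with inl i => a i | inr j => a' j end),
  (fun k => match fintype.split k with inl i => m i | inr j => m' j end).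
split=> [k|k|]; try by case: fintype.split.
rewrite big_split_ord; congr (_ + _); apply: eq_bigr => i _.
  by rewrite (unsplitK (inl i)).
by rewrite (unsplitK (inr i)).
Qed.

Lemma msum_ind (M' : set V) : M' 0 -> (forall x y, M' x -> M' y -> M' (x + y)) ->
  (forall a m, I a -> M m -> M' (act a m)) -> forall z, msum act I M z -> M' z.
Proof.
by move=> M0 MD Mact _ [n [a [m [ha hm ->]]]]; elim/big_ind: _ => // k _; exact: Mact.
Qed.

End SumsOfProducts.

(** * Finite quotients of A *)

Section RegularRing.
Variables (R : realType) (F : fieldType) (oo : place F).
Local Notation A := (regular_ring oo).
Local Notation nrm v := (place_abs R (sval v)).
Implicit Types v w : fplace oo.

Lemma place_abs_pval (v : place F) x : x != 0 -> place_abs R v x = 2 ^ (- v x).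
Proof. by move=> /negPf x0; rewrite /absv /= /place_abs_fun x0. Qed.

Lemma place_abs_le1 (v : place F) x : place_abs R v x <= 1 <-> 0 <= v x.
Proof.
have [->|x0] := eqVneq x 0; first by rewrite absv0 pval0 ler01.
rewrite place_abs_pval // -(expr0z (2 : R)).
by rewrite ler_eXz2l ?ltr1n // oppr_le0.
Qed.

Lemma regularP a : A a <-> forall v, nrm v a <= 1.
Proof.
split=> [Aa [v hv]|Aa v hv]; first exact/place_abs_le1/Aa.
exact/place_abs_le1/(Aa (exist _ v hv)).
Qed.

Lemma regular0 : A 0. Proof. by apply/regularP => v; rewrite absv0. Qed.
Lemma regular1 : A 1. Proof. by apply/regularP => v; rewrite absv1. Qed.

Lemma regularM a b : A a -> A b -> A (a * b).
Proof.
move=> /regularP ha /regularP hb; apply/regularP => v.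
by rewrite absvM mulr_ile1 ?absv_ge0.
Qed.

Lemma regularD a b : A a -> A b -> A (a + b).
Proof.
by move=> /regularP ha /regularP hb; apply/regularP => v; apply: absvD_le.
Qed.

Lemma regularN a : A a -> A (- a).
Proof. by move=> /regularP ha; apply/regularP => v; rewrite absvN. Qed.

Lemma regularB a b : A a -> A b -> A (a - b).
Proof. by move=> ha hb; apply/regularD/regularN. Qed.

Lemma regularX a n : A a -> A (a ^+ n).
Proof.
move=> ha; elim: n => [|n IH]; first by rewrite expr0; exact: regular1.
by rewrite exprS; apply: regularM.
Qed.

Lemma regular_sum (I : Type) (r : seq I) (P : pred I) (f : I -> F) :
  (forall i, P i -> A (f i)) -> A (\sum_(i <- r | P i) f i).
Proof. by move=> hf; elim/big_ind: _ => //; [exact: regular0|exact: regularD]. Qed.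

Lemma regular_prod (I : Type) (r : seq I) (P : pred I) (f : I -> F) :
  (forall i, P i -> A (f i)) -> A (\prod_(i <- r | P i) f i).
Proof. by move=> hf; elim/big_ind: _ => //; [exact: regular1|exact: regularM]. Qed.

Hypothesis hF : digit_collision F.

(** Reduction modulo [a] recovers the lowest digit. *)
Lemma digits_unique a (T : Type) (b : T -> F) : A a -> a != 0 ->
    (forall x, A (b x)) -> (forall x y, A ((b x - b y) / a) -> x = y) ->
  forall n (f g : 'I_n -> T),
    \sum_j b (f j) * a ^+ j = \sum_j b (g j) * a ^+ j -> f =1 g.
Proof.
move=> Aa a0 Ab incongr; elim=> [|n IH] f g; first by move=> _ [].
rewrite !big_ord_recl !expr0 !mulr1.
under eq_bigr do rewrite exprSr mulrA; rewrite -mulr_suml.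
under [X in _ = _ + X]eq_bigr do rewrite exprSr mulrA; rewrite -mulr_suml.
set S := (X in _ + X * a = _); set S' := (X in _ = _ + X * a) => eqs.
have AS (h : 'I_n.+1 -> T) : A (\sum_(i < n) b (h (lift ord0 i)) * a ^+ i).
  by apply: regular_sum => i _; apply: regularM => //; exact: regularX.
have e0 : f ord0 = g ord0.
  apply: incongr; have -> : b (f ord0) - b (g ord0) = (S' - S) * a.
    by rewrite mulrBl; apply/eqP; rewrite subr_eq addrAC [_ + b _]addrC -eqs addrK.
  by rewrite mulfK //; apply: regularB; apply: AS.
move=> j; have [j0 ->|->] := unliftP ord0 j; last exact: e0.
apply: (IH (fun i => f (lift ord0 i)) (fun i => g (lift ord0 i))).
by move: eqs; rewrite e0 => /addrI/mulIf; apply.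
Qed.

Lemma finite_quotient a : A a -> a != 0 -> exists Q : nat,
  forall (T : finType) (b : T -> F), (forall t, A (b t)) -> (Q < #|T|)%N ->
    exists x y, x != y /\ A ((b x - b y) / a).
Proof.
move=> Aa a0; have [Q hQ] := hF a; exists Q => T b Ab /(hQ T b)[s [u [u' [neq]]]].
move=> eqs; apply: contrapT => incongr; case/eqP: neq; apply/ffunP.
apply: (digits_unique Aa a0 Ab) eqs => x y h.
by apply: contrapT => /eqP nxy; apply: incongr; exists x, y.
Qed.

(** A list of pairwise incongruent elements that cannot be extended represents
    all classes, and the lengths of such lists are bounded. *)
Lemma representatives a : A a -> a != 0 -> exists l : seq F,
  (forall x, x \in l -> A x) /\
  forall x, A x -> exists2 y, y \in l & A ((x - y) / a).
Proof.
move=> Aa a0; have [Q hQ] := finite_quotient Aa a0.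
apply: contrapT => noreps.
pose incongr x y := ~~ `[< A ((x - y) / a) >].
have long n : exists l : seq F, [/\ size l = n, forall x, x \in l -> A x &
    pairwise incongr l].
  elim: n => [|n [l [sz hA hl]]]; first by exists [::].
  have [x Ax hx] : exists2 x, A x & forall y, y \in l -> ~ A ((x - y) / a).
    apply: contrapT => hx; apply: noreps; exists l; split=> // x Ax.
    apply: contrapT => hy; apply: hx; exists x => // y yl Axy.
    by apply: hy; exists y.
  exists (x :: l); split=> [/=|y|/=]; first by rewrite sz.
    by rewrite inE => /orP[/eqP->|/hA].
  by rewrite hl andbT; apply/allP => y /hx/asboolPn.
have [l [sz hA hl]] := long Q.+1.
have [||x [y [neq Axy]]] := hQ 'I_Q.+1 (fun i => l`_i).
- by move=> i; apply: hA; rewrite mem_nth // sz.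
- by rewrite card_ord.
have /(pairwiseP 0) hp := hl.
have lt i j : (i < j)%N -> (j < Q.+1)%N -> ~ A ((l`_i - l`_j) / a).
  move=> ij jQ; apply/asboolPn; apply: hp => //; rewrite inE sz //.
  exact: ltn_trans jQ.
case: (ltngtP x y) => [xy|yx|/val_inj exy]; last by rewrite exy eqxx in neq.
  exact: (lt x y).
by apply: (lt y x) => //; rewrite -opprB mulNr; exact: regularN.
Qed.

Lemma eventually_periodic a c : A a -> a != 0 -> A c ->
  exists i j, A (c ^+ i * (1 - c ^+ j.+1) / a).
Proof.
move=> Aa a0 Ac; have [Q hQ] := finite_quotient Aa a0.
have [||x [y [neq Axy]]] := hQ 'I_Q.+1 (fun i : 'I_Q.+1 => c ^+ i).
- by move=> i; exact: regularX.
- by rewrite card_ord.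
suff lt i j : (i < j)%N -> A ((c ^+ i - c ^+ j) / a) ->
    exists i j, A (c ^+ i * (1 - c ^+ j.+1) / a).
  case: (ltngtP x y) => [xy|yx|/val_inj exy]; last by rewrite exy eqxx in neq.
    exact: (lt x y).
  by apply: (lt y x) => //; rewrite -opprB mulNr; exact: regularN.
move=> ij h; exists i, (j - i.+1)%N.
by rewrite subnSK // mulrBr mulr1 -exprD subnKC // ltnW.
Qed.

(** * A denominator for every element of F *)

Section NonUnit.
Variable t : F.
Hypotheses (At : A t) (tVA : ~ A t^-1).

(** The leading coefficient is a denominator: at a place where its product with
    [f] is not regular, the leading term would exceed all the others. *)
Lemma denominator_of_relation n (c : 'I_n -> F) (f : F) :
  (forall i, A (c i)) -> (exists i, c i != 0) -> \sum_i c i * f ^+ i = 0 ->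
  exists d, [/\ A d, d != 0 & A (d * f)].
Proof.
move=> Ac [i0 ci0] rel.
have [m cm maxm] := @arg_maxnP _ i0 (fun i => c i != 0) (@nat_of_ord n) ci0.
exists (c m); split=> //; apply/regularP => v; rewrite leNgt; apply/negP => gt1.
have lec i : nrm v (c i) <= 1 by move/regularP: (Ac i).
have f1 : 1 < nrm v f.
  apply: lt_le_trans gt1 _; rewrite absvM; have := lec m.
  have := absv_ge0 (nrm v) f; nra.
have cm0 : 0 < nrm v (c m) by exact: absv_gt0.
have := absv_gt0 (nrm v) (_ : c m * f ^+ m != 0).
rewrite mulf_neq0 ?expf_neq0 //; last first.
  by apply/eqP => f0; move: f1; rewrite f0 absv0 ltr10.
move=> /(_ isT) top0.
have : nrm v (\sum_(i < n | i != m) c i * f ^+ i + c m * f ^+ m) = 0.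
  by move: rel; rewrite (bigD1 m) //= addrC => ->; rewrite absv0.
rewrite absvDl => [|]; first by move=> e; rewrite e ltxx in top0.
apply: absv_sum_lt => // i nim.
have [->|ci] := eqVneq (c i) 0; first by rewrite mul0r absv0.
have lt_im : (i < m)%N by rewrite ltn_neqAle nim; exact: maxm.
rewrite !absvM !absvX -(prednK (leq_ltn_trans (leq0n _) lt_im)) exprS mulrA.
rewrite absvM in gt1; apply: (@le_lt_trans _ _ (nrm v f ^+ m.-1)).
  apply: (@le_trans _ _ (nrm v f ^+ i)).
    by rewrite ler_piMl ?exprn_ge0 ?absv_ge0.
  by rewrite ler_eXn2l //; move: lt_im; case: (val m).
by rewrite ltr_pMl ?exprn_gt0 // (lt_trans ltr01).
Qed.

(** The digits are the polynomials in [f] with coefficients 0 and 1. Two equal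
    expansions in base [t] give an equation for [f] whose coefficients are
    polynomials in [t] with coefficients -1, 0 and 1, and such a polynomial
    vanishes only when its coefficients do: otherwise its lowest term would show
    that [t] is a unit. *)
Lemma denominator f : exists d, [/\ A d, d != 0 & A (d * f)].
Proof.
have t0 : t != 0 by apply: contra_not_neq tVA => ->; rewrite invr0; exact: regular0.
have [Q hQ] := hF t.
pose b (e : {ffun 'I_Q.+1 -> bool}) := \sum_i (e i)%:R * f ^+ i.
have [|s [u [u' [neq eqs]]]] := hQ _ b.
  by rewrite card_ffun card_bool card_ord (ltn_trans (ltnSn Q)) // ltn_expl.
pose c (i : 'I_Q.+1) : F := \sum_j ((u j i)%:R - (u' j i)%:R) * t ^+ j.
have Abool (x : bool) : A x%:R by case: x; [exact: regular1|exact: regular0].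
apply: (@denominator_of_relation _ c).
- move=> i; apply: regular_sum => j _.
  by apply: regularM; [exact: regularB|exact: regularX].
- apply: contrapT => c0; case/eqP: neq; apply/ffunP => j; apply/ffunP => i.
  have incongr (x y : bool) : A ((x%:R - y%:R) / t) -> x = y.
    case: x; case: y => //; rewrite ?subr0 ?sub0r ?mulNr mul1r // => h.
    by case: tVA; rewrite -[t^-1]opprK; exact: regularN.
  apply: (digits_unique At t0 Abool incongr (f := fun j => u j i)
            (g := fun j => u' j i)).
  apply/eqP; rewrite -subr_eq0 -sumrB.
  under eq_bigr do rewrite -mulrBl.
  by apply: contrapT => /negP ci; apply: c0; exists i.
under eq_bigr do rewrite mulr_suml.
rewrite exchange_big /=; move/eqP: eqs; rewrite -subr_eq0 -sumrB => /eqP eqs.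
rewrite -[RHS]eqs; apply: eq_bigr => j _; rewrite /b -mulrBl -sumrB mulr_suml.
by apply: eq_bigr => i _; rewrite -mulrBl mulrAC.
Qed.

(** Some [e] congruent to 1 modulo [H], hence nonzero modulo [a], is killed by a
    power of each element of [H], because powers repeat in the finite ring
    [A / aA]. Multiplying [e] by representatives of [H / aA], each as often as
    the product stays nonzero modulo [a], gives [b]. *)
Lemma annihilator (H : set F) a : A a -> a != 0 -> H a -> H `<=` A ->
    (forall x y, H x -> H y -> H (x + y)) ->
    (forall x y, A x -> H y -> H (x * y)) -> ~ H 1 ->
  exists b, [/\ A b, ~ A (b / a) & forall h, H h -> A (b * h / a)].
Proof.
move=> Aa a0 Ha HA HD HM H1; have [l [Al repl]] := representatives Aa a0.
have HaA x : A (x / a) -> H x.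
  by move=> h; rewrite -(divfK a0 x); exact: HM.
have nilp (hs : seq F) : (forall h, h \in hs -> H h) -> exists e,
    [/\ A e, H (1 - e) & forall h, h \in hs -> exists i, A (e * h ^+ i / a)].
  elim: hs => [|h hs IH] Hhs.
    exists 1; split=> //; first exact: regular1.
    by rewrite subrr -(mul0r a); apply: HM => //; exact: regular0.
  have [|e [Ae He hpow]] := IH; first by move=> x xs; apply: Hhs; rewrite inE xs orbT.
  have Hh : H h by apply: Hhs; rewrite mem_head.
  have [i [j per]] := eventually_periodic Aa a0 (HA _ Hh).
  have A1 : A (1 - h ^+ j.+1).
    by apply: regularB; [exact: regular1|apply/regularX/HA].
  exists (e * (1 - h ^+ j.+1)); split; first exact: regularM.
    have -> : 1 - e * (1 - h ^+ j.+1) = (1 - e) + e * h ^+ j * h.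
      by rewrite exprSr; ring.
    by apply: HD => //; apply: HM => //; apply: regularM => //; exact/regularX/HA.
  move=> x; rewrite inE => /orP[/eqP->|/hpow[k hk]].
    by exists i; rewrite -[e * _ * _]mulrA [_ * h ^+ i]mulrC -mulrA; exact: regularM.
  by exists k; rewrite [e * _ * _]mulrAC [_ * _ / a]mulrAC; exact: regularM.
have kill (hs : seq F) e : A e -> ~ A (e / a) -> (forall h, h \in hs -> A h) ->
    (forall h, h \in hs -> exists i, A (e * h ^+ i / a)) ->
    exists2 x, A x & ~ A (e * x / a) /\ forall h, h \in hs -> A (e * x * h / a).
  move=> Ae nAe; elim: hs => [|h hs IH] Ahs hpow.
    by exists 1; [exact: regular1|rewrite mulr1].
  have [||x Ax [nAx hx]] := IH.
  - by move=> y ys; apply: Ahs; rewrite inE ys orbT.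
  - by move=> y ys; apply: hpow; rewrite inE ys orbT.
  have Ah : A h by apply: Ahs; rewrite mem_head.
  have [i0 hi0] := hpow h (mem_head _ _).
  have exi : exists i, `[< A (e * x * h ^+ i / a) >].
    exists i0; apply/asboolP.
    have -> : e * x * h ^+ i0 / a = x * (e * h ^+ i0 / a) by ring.
    exact: regularM.
  have := ex_minnP exi; case=> -[|i] /asboolP hi mini.
    by case: nAx; rewrite expr0 mulr1 in hi.
  have Ahi : A (h ^+ i) by exact: regularX.
  exists (x * h ^+ i); [exact: regularM|split].
    by rewrite mulrA => /asboolP /mini; rewrite ltnn.
  move=> y; rewrite inE => /orP[/eqP->|/hx hy].
    by rewrite mulrA -[_ * h ^+ i * h]mulrA -exprSr.
  by rewrite mulrA [_ * h ^+ i * y]mulrAC [_ * h ^+ i / a]mulrAC; exact: regularM.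
pose hs := [seq h <- l | `[< H h >]].
have Hhs h : h \in hs -> H h by rewrite mem_filter => /andP[/asboolP].
have [e [Ae He /kill]] := nilp hs Hhs.
case=> //.
- move=> /HaA He'; apply: H1; rewrite -[1](subrK e); exact: HD.
- by move=> h /Hhs /HA.
move=> x Ax [nAx hx]; exists (e * x); split=> // [|h Hh]; first exact: regularM.
have [h' h'l hh'] := repl h (HA _ Hh).
have Hh' : H h'.
  rewrite -[h'](subKr h); apply: HD => //.
  by rewrite -mulN1r; apply: HM (HaA _ hh'); apply: regularN; exact: regular1.
rewrite -[h](subrK h') mulrDr mulrDl; apply: regularD.
  by rewrite -mulrA; apply: regularM => //; exact: regularM.
by apply: hx; rewrite mem_filter h'l andbT; apply/asboolP.
Qed.

(** * Invertible ideals *)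

(** If [I I^-1] were proper, some [b / a] outside [A] would map it into [A]. Then
    [b / a] maps [I^-1] to itself, its powers all lie in [I^-1], and so they are
    bounded at every place, which puts [b / a] in [A]. *)
Lemma invertible_ideal I : nonzero_ideal oo I ->
  msum *%R (ideal_inv oo I) I 1.
Proof.
move=> [IA ID IM [a Ia a0]]; apply: contrapT => not1.
have Iinv1 : ideal_inv oo I 1 by move=> x /IA; rewrite mul1r.
have Ha : msum *%R (ideal_inv oo I) I a by rewrite -[a]mul1r; exact: msum_in.
have HA x : msum *%R (ideal_inv oo I) I x -> A x.
  by move: x; apply: msum_ind; [exact: regular0|exact: regularD|move=> g i hg /hg].
have HM x y : A x -> msum *%R (ideal_inv oo I) I y ->
    msum *%R (ideal_inv oo I) I (x * y).
  move=> Ax; move: y; apply: msum_ind => [|y z hy hz|g i hg hi].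
  - by rewrite mulr0; exact: msum0.
  - by rewrite mulrDr; exact: msumD.
  - by rewrite mulrA; apply: msum_in => // j /hg; rewrite -mulrA; exact: regularM.
have [b [Ab nAba hb]] :=
  annihilator (HA a Ha) a0 Ha HA (fun x y => @msumD _ _ _ _ _ x y) HM not1.
apply: nAba; apply/regularP => v.
have powA n : A ((b / a) ^+ n * a).
  suff: ideal_inv oo I ((b / a) ^+ n) by apply.
  elim: n => [|n IH] i Ii; first by rewrite expr0 mul1r; exact: IA.
  have -> : (b / a) ^+ n.+1 * i = b * ((b / a) ^+ n * i) / a.
    by rewrite exprS; ring.
  by apply: hb; exact: msum_in.
apply: (@le1_of_bounded_powers _ _ (nrm v a)); first exact: absv_gt0.
by move=> n; rewrite -absvX -absvM; move/regularP: (powA n).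
Qed.

(** Fractional ideals, described without generators. *)
Definition fractional_module (I : set F) : Prop :=
  [/\ forall a b, I a -> I b -> I (a + b),
      forall a b, A a -> I b -> I (a * b),
      exists2 a, I a & a != 0 &
      exists2 c, c != 0 & forall i, I i -> A (c * i)].

Lemma fractional_invertible I : fractional_module I ->
  msum *%R (ideal_inv oo I) I 1.
Proof.
move=> [ID IM [a Ia a0] [c c0 cI]].
have : nonzero_ideal oo [set x | I (x / c)].
  split=> [x /cI|x y|x y|]; first by rewrite mulrCA divff // mulr1.
  - by move=> /= hx hy; rewrite mulrDl; exact: ID.
  - by move=> Ax hy /=; rewrite -mulrA; exact: IM.
  - by exists (c * a); rewrite /= ?mulf_neq0 // [c * a]mulrC mulfK.
move=> /invertible_ideal; move: (1 : F); apply: msum_ind => [|x y|g i hg hi].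
- exact: msum0.
- exact: msumD.
- have -> : g * i = (g * c) * (i / c) by rewrite mulrACA divff // mulr1.
  apply: msum_in => // j Ij.
  by rewrite -mulrA; apply: hg; rewrite /= [c * j]mulrC mulfK.
Qed.

(** Inverting [I] reduces membership in [I] to membership in [A], which is
    local by the definition of [A]. *)
Lemma local_membership I f : fractional_module I ->
  (forall v, exists2 i, I i & nrm v f <= nrm v i) -> I f.
Proof.
move=> hI hf; have [ID IM [a Ia _] _] := hI.
rewrite -[f]mul1r; move: (fractional_invertible hI); move: (1 : F).
apply: msum_ind => [|x y hx hy|g i hg hi].
- by rewrite mul0r -(mul0r a); apply: IM => //; exact: regular0.
- by rewrite mulrDl; exact: ID.
- rewrite mulrAC; apply: IM => //; apply/regularP => v.
  have [j Ij hj] := hf v; have /regularP/(_ v) := hg j Ij.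
  by apply: le_trans; rewrite !absvM ler_wpM2l ?absv_ge0.
Qed.

Lemma fractional_moduleP I : fractional_module I -> fractional_ideal oo I.
Proof.
move=> hI; have [ID IM I0 _] := hI; split=> //.
have [n [g [i [hg hi e1]]]] := fractional_invertible hI.
exists n, i; rewrite eqEsubset; split=> x.
  move=> Ix; exists (fun k => g k * x) => [k|]; first exact: hg.
  by under eq_bigr do rewrite mulrAC; rewrite -mulr_suml -e1 mul1r.
case=> a Aa ->; elim/big_ind: _ => // [|k _]; last exact: IM.
by have [b Ib _] := I0; rewrite -(mul0r b); apply: IM => //; exact: regular0.
Qed.

(** * Places and the Chinese remainder theorem *)

Lemma small_power (x e : R) : x < 1 -> 0 <= x -> 0 < e -> exists n, x ^+ n <= e.
Proof.
move=> x1; rewrite le_eqVlt => /orP[/eqP<-|x0] e0.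
  by exists 1%N; rewrite expr1 ltW.
apply: contrapT => hn; move: x1; rewrite ltNge; case/negP.
rewrite -[x]invrK invf_ge1 ?invr_gt0 //; apply: (le1_of_bounded_powers e0) => n.
rewrite exprVn mulrC ler_pdivrMr ?exprn_gt0 // mul1r leNgt.
by apply/negP => hlt; apply: hn; exists n; exact: ltW.
Qed.

Lemma small_element v e : 0 < e -> exists c, [/\ A c, c != 0 & nrm v c <= e].
Proof.
move=> e0; have [pi pi0 vpi] := pval_norm (sval v).
have [d [Ad d0 Adpi]] := denominator pi.
have c1 : nrm v (d * pi) < 1.
  rewrite absvM (place_abs_pval _ pi0) vpi; move/regularP: Ad => /(_ v).
  have := absv_ge0 (nrm v) d; have -> : 2 ^ (- 1) = 2^-1 :> R by [].
  lra.
have [n hn] := small_power c1 (absv_ge0 _ _) e0.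
exists ((d * pi) ^+ n); split; first exact: regularX.
  by rewrite expf_neq0 // mulf_neq0.
by rewrite absvX.
Qed.

(** The denominators [d] of [f] form the inverse of the fractional ideal
    [A + A f]. If they all vanished at [v], then 1 would too. *)
Lemma local_fraction v f : nrm v f <= 1 ->
  exists d, [/\ A d, nrm v d = 1 & A (d * f)].
Proof.
move=> hf; apply: contrapT => hd.
have lt1 d : A d -> A (d * f) -> nrm v d < 1.
  move=> Ad Adf; rewrite lt_neqAle; apply/andP; split; last by move/regularP: Ad.
  by apply/eqP => d1; apply: hd; exists d.
pose I := [set z | exists a b, [/\ A a, A b & z = a + b * f]].
have : fractional_module I.
  split.
  - move=> _ _ [a [b [Aa Ab ->]]] [a' [b' [Aa' Ab' ->]]].
    exists (a + a'), (b + b'); split; try exact: regularD.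
    by rewrite mulrDl addrACA.
  - move=> x _ Ax [a [b [Aa Ab ->]]].
    exists (x * a), (x * b); split; try exact: regularM.
    by rewrite mulrDr mulrA.
  - exists 1; last exact: oner_neq0; exists 1, 0; rewrite mul0r addr0.
    by split=> //; [exact: regular1|exact: regular0].
  - have [c [Ac c0 Acf]] := denominator f; exists c => // _ [a [b [Aa Ab ->]]].
    by rewrite mulrDr mulrCA; apply: regularD; exact: regularM.
move=> /fractional_invertible h; suff: nrm v 1 < 1 by rewrite absv1 ltxx.
move: h; move: (1 : F); apply: (@msum_ind _ _ _ _ _ (fun z => nrm v z < 1)).
- by rewrite absv0.
- by move=> x y; exact: absvD_lt.
move=> g _ hg [a [b [Aa Ab ->]]].
have Ag : A g.
  rewrite -[g]mulr1; apply: hg; exists 1, 0; rewrite mul0r addr0.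
  by split=> //; [exact: regular1|exact: regular0].
have Agf : A (g * f).
  apply: hg; exists 0, 1; rewrite mul1r add0r.
  by split=> //; [exact: regular0|exact: regular1].
rewrite absvM; have := lt1 g Ag Agf.
have : nrm v (a + b * f) <= 1.
  apply: absvD_le; first by move/regularP: Aa.
  by rewrite absvM mulr_ile1 ?absv_ge0 //; move/regularP: Ab.
have := absv_ge0 (nrm v) g; have := absv_ge0 (nrm v) (a + b * f); nra.
Qed.

(** The powers of [d] repeat modulo [a], and [d] can be cancelled at [v]. *)
Lemma unit_power v d a : A d -> nrm v d = 1 -> A a -> a != 0 ->
  exists j, nrm v (1 - d ^+ j.+1) <= nrm v a.
Proof.
move=> Ad d1 Aa a0; have [i [j /regularP/(_ v)]] := eventually_periodic Aa a0 Ad.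
rewrite !absvM absvX d1 expr1n mul1r absvV ler_pdivrMr ?absv_gt0 // mul1r.
by exists j.
Qed.

Lemma pvalXz (v : place F) x (n : int) : x != 0 -> v (x ^ n) = n * v x.
Proof.
move=> x0; have v1 : v 1 = 0.
  by apply: (@addrI _ (v 1)); rewrite -pvalM ?oner_neq0 // mulr1 addr0.
have pos (m : nat) : v (x ^+ m) = m%:Z * v x.
  elim: m => [|m IH]; first by rewrite expr0 v1 mul0r.
  by rewrite exprS pvalM ?expf_neq0 // IH intS mulrDl mul1r.
case: n => m; first exact: pos.
have : v (x ^+ m.+1 * x ^- m.+1) = 0 by rewrite divff ?expf_neq0.
rewrite pvalM ?invr_neq0 ?expf_neq0 // pos => /eqP.
by rewrite addrC addr_eq0 => /eqP; rewrite NegzE mulNr => <-.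
Qed.

Lemma place_abs_lt1 (v : place F) x : x != 0 -> place_abs R v x < 1 <-> 0 < v x.
Proof.
move=> x0; rewrite place_abs_pval // -[X in _ < X](expr0z (2 : R)).
by rewrite ltr_eXz2l ?ltr1n // oppr_lt0.
Qed.

Lemma place_abs_eq1 (v : place F) x : x != 0 -> place_abs R v x = 1 <-> v x = 0.
Proof.
move=> x0; split=> [e1|e0].
  apply: le_anti; rewrite (iffLR (place_abs_le1 _ _)) ?e1 // andbT leNgt.
  by apply/negP => /(place_abs_lt1 _ x0); rewrite e1 ltxx.
by rewrite place_abs_pval // e0 oppr0 expr0z.
Qed.

(** The center of [v] is maximal, hence equal to that of [w], and units at [v]
    are units at [w]. Writing elements of [F] as fractions with denominator a
    unit at [v] shows that the valuations are proportional, and both are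
    normalized. *)
Lemma place_of_center v w :
  (forall a, A a -> nrm v a < 1 -> nrm w a < 1) -> v = w.
Proof.
move=> vw.
have unit d : A d -> nrm v d = 1 -> nrm w d = 1.
  move=> Ad d1; have [a [Aa a0 ha]] : exists a, [/\ A a, a != 0 & nrm v a <= 2^-1].
    by apply: small_element; rewrite invr_gt0.
  have [j hj] := unit_power Ad d1 Aa a0.
  have lt1 : nrm w (1 - d ^+ j.+1) < 1.
    apply: vw; first by apply: regularB; [exact: regular1|exact: regularX].
    by apply: le_lt_trans hj _; lra.
  have : nrm w (d ^+ j.+1) = 1.
    have -> : d ^+ j.+1 = - (1 - d ^+ j.+1) + 1 by ring.
    by rewrite absvDl absv1 // absvN.
  by rewrite absvX => /eqP; rewrite pexpr_eq1 ?absv_ge0 // => /eqP.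
have int f : nrm v f < 1 -> nrm w f < 1.
  move=> hf; have [d [Ad d1 Adf]] := local_fraction (ltW hf).
  have := vw (d * f) Adf; rewrite !absvM d1 (unit d Ad d1) !mul1r; exact.
have int1 f : nrm v f = 1 -> nrm w f = 1.
  move=> hf; have [d [Ad d1 Adf]] : exists d, [/\ A d, nrm v d = 1 & A (d * f)].
    by apply: local_fraction; rewrite hf.
  have := unit (d * f) Adf; rewrite !absvM d1 hf (unit d Ad d1) !mul1r; exact.
have [pi pi0 vpi] := pval_norm (sval v).
have scale f : f != 0 -> sval w f = sval v f * sval w pi.
  move=> f0; have q0 : f * pi ^ (- sval v f) != 0.
    by rewrite mulf_neq0 ?expfz_neq0.
  have /(place_abs_eq1 _ q0) : nrm w (f * pi ^ (- sval v f)) = 1.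
    apply: int1; apply/place_abs_eq1 => //.
    by rewrite pvalM ?expfz_neq0 // pvalXz // vpi mulr1 subrr.
  rewrite pvalM ?expfz_neq0 // pvalXz // mulNr.
  by move=> /eqP; rewrite subr_eq0 => /eqP.
have wpi : sval w pi = 1.
  have [sg sg0 wsg] := pval_norm (sval w).
  have := scale sg sg0; rewrite wsg.
  have : 0 < sval w pi.
    by apply/(place_abs_lt1 _ pi0)/int/(place_abs_lt1 _ pi0); rewrite vpi.
  move: (sval v sg) (sval w pi) => a b b0 e1.
  have a0 : 0 < a by rewrite -(pmulr_lgt0 _ b0) -e1.
  have : 0 <= (a - 1) * (b - 1) by rewrite mulr_ge0 ?subr_ge0 // gtz0_ge1.
  by rewrite mulrBl mulrBr -e1; lia.
have eqvw : sval v = sval w.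
  have : pval (sval v) = pval (sval w).
    apply: funext => f; have [->|f0] := eqVneq f 0; first by rewrite !pval0.
    by rewrite scale // wpi mulr1.
  case: (sval v) => x x0 xM xD xn; case: (sval w) => y y0 yM yD yn /= exy.
  by subst y; congr Place; exact: Prop_irrelevance.
clear -eqvw; case: v w eqvw => v hv [w hw] /= evw; subst w.
by congr exist; exact: Prop_irrelevance.
Qed.

Lemma separate_places v w : v <> w ->
  exists c, [/\ A c, nrm v c = 1 & nrm w c < 1].
Proof.
move=> nvw; apply: contrapT => hc; apply: nvw; symmetry; apply: place_of_center.
move=> a Aa wa; rewrite lt_neqAle; apply/andP; split; last by move/regularP: Aa.
by apply/eqP => va; apply: hc; exists a.
Qed.

(** The center of a zero of [a] is determined by its image in the finite ring
    [A / aA]. *)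
Lemma finite_zeros a : A a -> a != 0 -> finite_set [set v : fplace oo | nrm v a < 1].
Proof.
move=> Aa a0; have [l [Al repl]] := representatives Aa a0.
pose center v := [ffun i : 'I_(size l) => nrm v l`_i < 1].
have injc : {in [set v : fplace oo | nrm v a < 1] &, injective center}.
  move=> v w; rewrite !inE /= => va wa /ffunP ec; apply: place_of_center => b Ab vb.
  have [y yl Aby] := repl b Ab.
  have sm (u : fplace oo) : nrm u a < 1 -> nrm u (b - y) < 1.
    move=> ua; rewrite -(divfK a0 (b - y)) absvM.
    move/regularP: Aby => /(_ u); have := absv_ge0 (nrm u) ((b - y) / a).
    have := absv_ge0 (nrm u) a; nra.
  have ltyl : (index y l < size l)%N by rewrite index_mem.
  have := ec (Ordinal ltyl); rewrite !ffunE /= nth_index // => ey.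
  rewrite -[b](subrK y); apply: absvD_lt; first exact: sm.
  by rewrite -ey -[y](subKr b); apply: absvB_lt => //; exact: sm.
by have := inj_card_eq injc; move=> /eq_finite_set <-; exact: finite_finset.
Qed.

(** Some [c] is a unit at [v] and small at the places of [s]; a power of it is
    moreover close to 1 at [v]. *)
Lemma crt_idempotent v (s : seq {classic fplace oo}) a :
  A a -> a != 0 -> (v : {classic fplace oo}) \notin s ->
  exists e, [/\ A e, nrm v (1 - e) <= nrm v a &
    forall w, (w : {classic fplace oo}) \in s -> nrm w e <= nrm w a].
Proof.
move=> Aa a0 vs.
have le1 (u : fplace oo) x : A x -> nrm u x <= 1 by move=> /regularP.
have [c [Ac vc hc]] : exists c, [/\ A c, nrm v c = 1 &
    forall w, (w : {classic fplace oo}) \in s -> nrm w c <= nrm w a].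
  elim: s vs => [|w s IH]; first by exists 1; split=> //; [exact: regular1|exact: absv1].
  rewrite inE negb_or => /andP[/eqP nvw /IH[c [Ac vc hc]]].
  have [b [Ab vb wb]] := separate_places nvw.
  have [n hn] := small_power wb (absv_ge0 _ _) (absv_gt0 (nrm w) a0).
  exists (b ^+ n * c); split; first by apply: regularM => //; exact: regularX.
    by rewrite absvM absvX vb vc expr1n mulr1.
  move=> u; rewrite inE absvM => /orP[/eqP->|/hc us].
    by rewrite absvX; apply: le_trans hn; rewrite ler_piMr ?exprn_ge0 ?absv_ge0 ?le1.
  by apply: le_trans us; rewrite ler_piMl ?absv_ge0 // le1 //; exact: regularX.
have [j hj] := unit_power Ac vc Aa a0.
exists (c ^+ j.+1); split=> // [|w ws]; first exact: regularX.
apply: le_trans (hc w ws); rewrite exprS absvM ler_piMr ?absv_ge0 //.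
by apply: le1; exact: regularX.
Qed.

(** * Integral adeles *)

Section Completions.
Variable K : completions R oo.
Local Notation lnrm v := (cabs (loc K (sval v))).
Implicit Types y z : locprod K.

Lemma diag_abs v f : lnrm v (diag K f v) = nrm v f.
Proof. exact: cabs_emb. Qed.

Lemma diagB_abs v f g : lnrm v (diag K f v - diag K g v) = nrm v (f - g).
Proof. by rewrite -(cabs_emb (loc K (sval v))) rmorphB. Qed.

Definition integral y : Prop := forall v, lnrm v (y v) <= 1.

(** Approximate [y v] by a fraction [b / d] with [d] a unit at [v], then replace
    the inverse of [d] by a power of [d]. *)
Lemma local_approximation y v a : integral y -> A a -> a != 0 ->
  exists2 b, A b & lnrm v (y v - diag K b v) <= nrm v a.
Proof.
move=> hy Aa a0; have [f hf] := cdense (y v) (absv_gt0 (nrm v) a0).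
have a1 : nrm v a <= 1 by move/regularP: Aa.
have f1 : nrm v f <= 1.
  rewrite -(cabs_emb (loc K (sval v))) -[cemb _ _](subKr (y v)).
  by apply: absvB_le; [exact: hy|exact: le_trans (ltW hf) _].
have [d [Ad d1 Adf]] := local_fraction f1.
have [j hj] := unit_power Ad d1 Aa a0.
exists (d ^+ j * (d * f)); first by apply: regularM => //; exact: regularX.
rewrite -[y v](subrK (cemb (loc K (sval v)) f)) -addrA.
apply: absvD_le; first exact: ltW.
rewrite diagB_abs (_ : f - _ = (1 - d ^+ j.+1) * f); last by rewrite exprS; ring.
by rewrite absvM; apply: le_trans hj; rewrite ler_piMr ?absv_ge0.
Qed.

(** At the places where [a] is a unit the estimate holds for every [b] in [A];
    the others are finite in number. *)
Lemma strong_approximation y a : integral y -> A a -> a != 0 ->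
  exists2 b, A b & forall v, lnrm v (y v - diag K b v) <= nrm v a.
Proof.
move=> hy Aa a0.
have approx (s : seq {classic fplace oo}) : exists2 b, A b &
    forall v, (v : {classic fplace oo}) \in s ->
      lnrm v (y v - diag K b v) <= nrm v a.
  elim: s => [|v s [b Ab hb]]; first by exists 0; [exact: regular0|].
  have [vs|vs] := boolP ((v : {classic fplace oo}) \in s).
    by exists b => // w; rewrite inE => /orP[/eqP->|]; exact: hb.
  have [e [Ae e1 es]] := crt_idempotent Aa a0 vs.
  have [c Ac hc] := local_approximation v hy Aa a0.
  have Abc : A (c - b) by exact: regularB.
  exists (b + e * (c - b)); first by apply: regularD => //; exact: regularM.
  move=> w; rewrite inE => /orP[/eqP->|ws].
    rewrite -[y v](subrK (diag K c v)) -addrA; apply: absvD_le => //.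
    rewrite diagB_abs (_ : _ - _ = (1 - e) * (c - b)); last by ring.
    rewrite absvM; apply: le_trans e1; rewrite ler_piMr ?absv_ge0 //.
    by move/regularP: Abc.
  rewrite -[y w](subrK (diag K b w)) -addrA; apply: absvD_le; first exact: hb.
  rewrite diagB_abs (_ : _ - _ = e * (b - c)); last by ring.
  rewrite absvM; apply: le_trans (es w ws); rewrite ler_piMr ?absv_ge0 //.
  by rewrite -absvN opprB; move/regularP: Abc.
have /finite_seqP[s hs] :
    finite_set ([set v | nrm v a < 1] : set {classic fplace oo}).
  exact: finite_zeros.
have [b Ab hb] := approx s.
exists b => // v.
have [va|va] := ltP (nrm v a) 1; first by apply: hb; have : [set` s] v by rewrite -hs.
apply: le_trans va; apply: absvB_le; first exact: hy.
by rewrite diag_abs; move/regularP: Ab.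
Qed.

Lemma nonzero_ideal_fractional I : nonzero_ideal oo I -> fractional_module I.
Proof.
move=> [IA ID IM I0]; split=> //; exists 1; first exact: oner_neq0.
by move=> i /IA; rewrite mul1r.
Qed.

(** To see an integral adele as a compatible family, approximate it for each
    ideal [I] with the precision of a nonzero element of [I]. The compatibility
    modulo [J] can be tested at each place, where [local_membership] applies. *)
Lemma Ahat_integral y : Ahat y <-> integral y.
Proof.
split=> [[a [Aa _] lim] v|hy].
  have [I0 hI0 /(_ I0 hI0 (@subset_refl _ _)) lt1] := lim v 1 ltr01.
  rewrite -[y v](subrK (diag K (a I0) v)); apply: absvD_le; first exact: ltW.
  by rewrite diag_abs; move/regularP: (Aa I0 hI0).
have approx (I : set F) : exists b, nonzero_ideal oo I -> A b /\
    exists a, [/\ I a, a != 0 & forall v, lnrm v (y v - diag K b v) <= nrm v a].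
  have [hI|hI] := pselect (nonzero_ideal oo I); last by exists 0.
  have [IA _ _ [a Ia a0]] := hI.
  have [b Ab hb] := strong_approximation hy (IA _ Ia) a0.
  by exists b => _; split=> //; exists a.
have [b hb] := choice approx; exists b.
  split=> [I /hb[]//|I J hI hJ IJ].
  have [_ [a [Ia _ haI]]] := hb I hI; have [_ [a' [Ja' _ haJ]]] := hb J hJ.
  apply: local_membership; first exact: nonzero_ideal_fractional.
  move=> v; have hv : nrm v (b I - b J) <= Num.max (nrm v a) (nrm v a').
    rewrite -diagB_abs; have -> : diag K (b I) v - diag K (b J) v =
        (y v - diag K (b J) v) - (y v - diag K (b I) v) by ring.
    by apply: absvB_le; rewrite le_max ?haI ?haJ ?orbT.
  move: hv; rewrite le_max => /orP[h|h]; [by exists a => //; exact: IJ|by exists a'].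
move=> v e e0; have [c [Ac c0 hc]] : exists c, [/\ A c, c != 0 & nrm v c <= e / 2].
  by apply: small_element; lra.
exists [set x | A (x / c)].
  split=> [x|x z|x z|]; rewrite /=.
  - by move=> h; rewrite -(divfK c0 x); exact: regularM.
  - by move=> hx hz; rewrite mulrDl; exact: regularD.
  - by move=> hx hz; rewrite -mulrA; exact: regularM.
  - by exists c => //=; rewrite divff //; exact: regular1.
move=> I hI Ic; have [_ [a [Ia _ ha]]] := hb I hI.
apply: le_lt_trans (ha v) _; have /regularP/(_ v) := Ic _ Ia.
rewrite absvM absvV ler_pdivrMr ?absv_gt0 // mul1r => h; lra.
Qed.

Lemma integralD y z : integral y -> integral z -> integral (y + z).
Proof. by move=> hy hz v; apply: absvD_le; [exact: hy|exact: hz]. Qed.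

Lemma integralM y z : integral y -> integral z -> integral (y * z).
Proof. by move=> hy hz v; rewrite absvM mulr_ile1 ?absv_ge0 ?hy ?hz. Qed.

Lemma integralN y : integral y -> integral (- y).
Proof. by move=> hy v; rewrite absvN; exact: hy. Qed.

Lemma integral0 : integral 0.
Proof. by move=> v; rewrite absv0. Qed.

Lemma integral_diag a : integral (diag K a) <-> A a.
Proof.
by split=> [h|/regularP h]; [apply/regularP|]=> v; move: (h v); rewrite diag_abs.
Qed.

Lemma clear_denominator z : adelic z ->
  exists d, [/\ A d, d != 0 & integral (diag K d * z)].
Proof.
move=> hz; pose X : set {classic fplace oo} := [set v | ~ (lnrm v (z v) <= 1)].
have /finite_seqP[s hs] : finite_set X by [].
have [d [Ad d0 hd]] : exists d, [/\ A d, d != 0 & forall v : fplace oo,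
    (v : {classic fplace oo}) \in s -> nrm v d * lnrm v (z v) <= 1].
  elim: s {hs} => [|v s [d [Ad d0 hd]]].
    by exists 1; split=> //; [exact: regular1|exact: oner_neq0].
  have z0 := absv_ge0 (lnrm v) (z v).
  have [c [Ac c0 hc]] : exists c, [/\ A c, c != 0 & nrm v c <= (1 + lnrm v (z v))^-1].
    by apply: small_element; rewrite invr_gt0; lra.
  have le1 (w : fplace oo) x : A x -> nrm w x <= 1 by move=> /regularP.
  exists (c * d); split; [exact: regularM|exact: mulf_neq0|move=> w].
  rewrite inE absvM => /orP[/eqP->|/hd h].
    apply: (@le_trans _ _ (nrm v c * lnrm v (z v))).
      by rewrite ler_wpM2r // ler_piMr ?absv_ge0 ?le1.
    apply: (@le_trans _ _ ((1 + lnrm v (z v))^-1 * lnrm v (z v))).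
      by rewrite ler_wpM2r.
    by rewrite mulrC ler_pdivrMr; lra.
  apply: le_trans h; rewrite ler_wpM2r ?absv_ge0 //.
  by rewrite ler_piMl ?absv_ge0 ?le1.
exists d; split=> // v; rewrite absvM diag_abs.
have [zv|zv] := pselect (lnrm v (z v) <= 1).
  by rewrite mulr_ile1 ?absv_ge0 //; move/regularP: Ad.
by apply: hd; have : [set` s] v by rewrite -hs.
Qed.

(** * The ideal of an idele *)

Section IdealOfIdele.
Variable x : adele_unit K.
Local Notation J := (idealJ x).

Lemma au_mulV v : au x v * auV x v = 1.
Proof. by rewrite -[RHS]/((1 : locprod K) v) -(auK x). Qed.

Lemma au_abs_gt0 v : 0 < lnrm v (au x v).
Proof.
apply: absv_gt0; apply/eqP => e.
by have /eqP := au_mulV v; rewrite e mul0r eq_sym oner_eq0.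
Qed.

Lemma auV_abs v : lnrm v (auV x v) = (lnrm v (au x v))^-1.
Proof.
have x0 := au_abs_gt0 v; apply: (mulfI (lt0r_neq0 x0)).
by rewrite divff ?gt_eqF // -absvM au_mulV absv1.
Qed.

Lemma idealJP f : J f <-> forall v, nrm v f <= lnrm v (au x v).
Proof.
split=> [[y /Ahat_integral hy e] v|h].
  rewrite -diag_abs e absvM ler_piMr ?absv_ge0 //; exact: hy.
exists (auV x * diag K f); last by rewrite mulrA auK mul1r.
apply/Ahat_integral => v; rewrite absvM diag_abs auV_abs mulrC.
by rewrite ler_pdivrMr ?au_abs_gt0 // mul1r.
Qed.

Lemma idele_lower_bound : exists d,
  [/\ A d, d != 0 & forall v, nrm v d <= lnrm v (au x v)].
Proof.
have [d [Ad d0 hd]] := clear_denominator (auV_adelic x).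
exists d; split=> // v; have := hd v; rewrite absvM diag_abs auV_abs.
by rewrite ler_pdivrMr ?au_abs_gt0 // mul1r.
Qed.

Lemma idele_upper_bound : exists d,
  [/\ A d, d != 0 & forall v, nrm v d * lnrm v (au x v) <= 1].
Proof.
have [d [Ad d0 hd]] := clear_denominator (au_adelic x).
by exists d; split=> // v; have := hd v; rewrite absvM diag_abs.
Qed.

Lemma idealJ_fractional : fractional_module J.
Proof.
split.
- by move=> a b /idealJP ha /idealJP hb; apply/idealJP => v; exact: absvD_le.
- move=> a b /regularP ha /idealJP hb; apply/idealJP => v.
  by rewrite absvM; apply: le_trans (hb v); rewrite ler_piMl ?absv_ge0.
- have [d [_ d0 hd]] := idele_lower_bound; exists d => //; exact/idealJP.
- have [d [_ d0 hd]] := idele_upper_bound; exists d => // i /idealJP hi.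
  apply/regularP => v; rewrite absvM; apply: le_trans (hd v).
  by rewrite ler_wpM2l ?absv_ge0.
Qed.

(** Multiply [x] by a denominator [d'] and approximate it by an element of [A]
    to the precision of a lower bound, strict at the place [v]. *)
Lemma idealJ_attains v : exists2 j, J j & nrm v j = lnrm v (au x v).
Proof.
have [d [Ad d0 hd]] := idele_lower_bound.
have [d' [Ad' d'0 hd']] := idele_upper_bound.
have [c [Ac c0 hc]] : exists c, [/\ A c, c != 0 & nrm v c <= 2^-1].
  by apply: small_element; rewrite invr_gt0.
(* The factor [c] makes the approximation at [v] finer than [d' x] itself. *)
have [|||b Ab hb] := @strong_approximation (diag K d' * au x) (d' * d * c).
- by move=> w; rewrite absvM diag_abs.
- by apply: regularM => //; exact: regularM.
- by rewrite !mulf_neq0.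
have d'_gt0 w := absv_gt0 (nrm w) d'0.
exists (b / d').
  apply/idealJP => w; rewrite absvM absvV ler_pdivrMr // mulrC -diag_abs.
  rewrite -[diag K b w](subKr ((diag K d' * au x) w)).
  apply: absvB_le; first by rewrite absvM diag_abs.
  apply: le_trans (hb w) _; rewrite !absvM -mulrA ler_wpM2l ?absv_ge0 //.
  by apply: le_trans (hd w); rewrite ler_piMr ?absv_ge0 //; move/regularP: Ac.
rewrite absvM absvV; apply: (mulIf (lt0r_neq0 (d'_gt0 v))).
have -> : nrm v b = lnrm v (- ((diag K d' * au x) v - diag K b v)
                              + (diag K d' * au x) v).
  by rewrite opprB subrK diag_abs.
rewrite divfK ?gt_eqF // absvDl absvM diag_abs; first by rewrite mulrC.
rewrite absvN; apply: le_lt_trans (hb v) _; rewrite !absvM -mulrA ltr_pM2l //.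
have := hd v; have := au_abs_gt0 v; have := absv_ge0 (nrm v) c.
have := absv_ge0 (nrm v) d; nra.
Qed.

(** As [J] attains the valuation of [x] everywhere, [f J] lies in [A] only if
    [f x] is integral. *)
Lemma inv_idealJP f : ideal_inv oo J f <-> integral (au x * diag K f).
Proof.
split=> [h v|h j /idealJP hj].
  have [j Jj hj] := idealJ_attains v; have /regularP/(_ v) := h j Jj.
  by rewrite absvM hj => le1; rewrite absvM diag_abs mulrC.
apply/regularP => v; apply: le_trans (h v).
rewrite [in leRHS]absvM diag_abs absvM mulrC.
by rewrite ler_wpM2r ?absv_ge0.
Qed.

End IdealOfIdele.

(** * The modules F^r cap g Ahat^r *)

Definition integral_mx m n (M : 'M[locprod K]_(m, n)) : Prop :=
  forall i j, integral (M i j).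

Lemma integral_addmx m n (M M' : 'M[locprod K]_(m, n)) :
  integral_mx M -> integral_mx M' -> integral_mx (M + M').
Proof. by move=> hM hM' i j; rewrite mxE; exact: integralD. Qed.

Lemma integral_oppmx m n (M : 'M[locprod K]_(m, n)) :
  integral_mx M -> integral_mx (- M).
Proof. by move=> hM i j; rewrite mxE; exact: integralN. Qed.

Lemma integral_subr m n (M M' : 'M[locprod K]_(m, n)) :
  integral_mx M' -> integral_mx (M - M') <-> integral_mx M.
Proof.
move=> hM'; split=> h; last exact/integral_addmx/integral_oppmx.
by rewrite -[M](subrK M'); exact: integral_addmx.
Qed.

Lemma integral_scalemx m n y (M : 'M[locprod K]_(m, n)) :
  integral y -> integral_mx M -> integral_mx (y *: M).
Proof. by move=> hy hM i j; rewrite mxE; exact: integralM. Qed.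

Lemma integral_mulmx m n q (M : 'M[locprod K]_(m, n)) (M' : 'M_(n, q)) :
  integral_mx M -> integral_mx M' -> integral_mx (M *m M').
Proof.
move=> hM hM' i j; rewrite mxE; elim/big_ind: _ => [||k _].
- exact: integral0.
- exact: integralD.
- exact: integralM.
Qed.

Lemma integral_map_diag m n (w : 'M[F]_(m, n)) :
  (forall i j, A (w i j)) -> integral_mx (map_mx (diag K) w).
Proof. by move=> hw i j; rewrite mxE; exact/integral_diag. Qed.

Lemma vec_AhatP r (y : 'cV[locprod K]_r) : vec_Ahat y <-> integral_mx y.
Proof.
split=> [h i j|h j]; last exact/Ahat_integral.
by rewrite (ord1 j); exact/Ahat_integral.
Qed.

Lemma hat_imageP r (g h : 'M[locprod K]_r) : g *m h = 1%:M -> h *m g = 1%:M ->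
  forall z : 'cV[locprod K]_r,
    (exists2 y, vec_Ahat y & z = g *m y) <-> integral_mx (h *m z).
Proof.
move=> gh hg z; split=> [[y /vec_AhatP hy ->]|hz].
  by rewrite mulmxA hg mul1mx.
by exists (h *m z); [exact/vec_AhatP|rewrite mulmxA gh mul1mx].
Qed.

Lemma map_diagZ m n a (w : 'M[F]_(m, n)) :
  map_mx (diag K) (a *: w) = diag K a *: map_mx (diag K) w.
Proof. exact: map_mxZ. Qed.

Lemma adelicD y z : adelic y -> adelic z -> adelic (y + z).
Proof.
move=> hy hz; apply: (@sub_finite_set _ _ ([set v | ~ (lnrm v (y v) <= 1)] `|`
   [set v | ~ (lnrm v (z v) <= 1)])); last by rewrite finite_setU.
move=> v /= h; apply: contrapT => /not_orP[/contrapT h1 /contrapT h2]; apply: h.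
exact: absvD_le.
Qed.

Lemma integral_adelic y : integral y -> adelic y.
Proof.
move=> hy; apply: (sub_finite_set _ (finite_set0 (fplace oo))) => v /=; apply.
exact: hy.
Qed.

Lemma diag_adelic f : adelic (diag K f).
Proof.
have [d [Ad d0 Adf]] := denominator f.
apply: (sub_finite_set _ (finite_zeros Ad d0)) => v /= h.
rewrite ltNge; apply/negP => d1; apply: h; rewrite diag_abs.
have /regularP/(_ v) := Adf; rewrite absvM; apply: le_trans.
by rewrite ler_peMl ?absv_ge0.
Qed.

Lemma adelic_mulmx m n q (M : 'M[locprod K]_(m, n)) (M' : 'M_(n, q)) :
  (forall i j, adelic (M i j)) -> (forall i j, adelic (M' i j)) ->
  forall i j, adelic ((M *m M') i j).
Proof.
move=> hM hM' i j; rewrite mxE; elim/big_ind: _ => [||k _].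
- exact/integral_adelic/integral0.
- exact: adelicD.
- exact: adelicM.
Qed.

Lemma adelic_map_diag m n (w : 'M[F]_(m, n)) i j :
  adelic (map_mx (diag K) w i j).
Proof. by rewrite mxE; exact: diag_adelic. Qed.

Lemma clear_denominators m n (M : 'M[locprod K]_(m, n)) :
  (forall i j, adelic (M i j)) ->
  exists d, [/\ A d, d != 0 & integral_mx (diag K d *: M)].
Proof.
move=> hM; pose z (ij : 'I_m * 'I_n) := M ij.1 ij.2.
have /choice [d hd] : forall ij, exists d, [/\ A d, d != 0 & integral (diag K d * z ij)].
  by move=> ij; exact/clear_denominator/hM.
exists (\prod_ij d ij); split.
- by apply: regular_prod => ij _; case: (hd ij).
- by apply/prodf_neq0 => ij _; case: (hd ij).
- move=> i j; rewrite mxE (bigD1 (i, j)) //= rmorphM mulrAC.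
  apply: integralM; first by case: (hd (i, j)).
  by apply/integral_diag/regular_prod => ij _; case: (hd ij).
Qed.

(** Density of [F] in the finite adeles, reduced to [strong_approximation] by a
    common denominator [c] of the entries of [z]. *)
Lemma adelic_approximation r (z : 'cV[locprod K]_r) d :
  (forall i j, adelic (z i j)) -> A d -> d != 0 ->
  exists u (y : 'cV[locprod K]_r),
    integral_mx y /\ z - map_mx (diag K) u = diag K d *: y.
Proof.
move=> hz Ad d0; have [c [Ac c0 hc]] := clear_denominators hz.
have /choice [b hb] : forall i, exists b, A b /\ forall v,
    lnrm v ((diag K c *: z) i 0 v - diag K b v) <= nrm v (c * d).
  move=> i; have [|||b Ab hb] := @strong_approximation ((diag K c *: z) i 0) (c * d).
  - exact: hc.
  - exact: regularM.
  - exact: mulf_neq0.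
  - by exists b.
exists (\col_i (b i / c)), (diag K d^-1 *: (z - map_mx (diag K) (\col_i (b i / c)))).
split; last by rewrite scalerA -rmorphM divff // rmorph1 scale1r.
move=> i j v; rewrite (ord1 j) {j} !mxE.
have cd_gt0 : 0 < nrm v (c * d) by apply/absv_gt0/mulf_neq0.
have -> : (diag K d^-1 * (z i 0 - diag K (b i / c))) =
   diag K (c * d)^-1 * ((diag K c *: z) i 0 - diag K (b i)).
  rewrite mxE invfM [c^-1 * _]mulrC [in RHS]rmorphM -mulrA; congr (_ * _).
  by rewrite mulrBr mulrA -!rmorphM mulVf // rmorph1 mul1r [b i / c]mulrC.
rewrite absvM diag_abs absvV mulrC ler_pdivrMr // mul1r.
by case: (hb i) => _ /(_ v).
Qed.

Section FrCap.
Variables (r : nat).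
Implicit Types g k : adeleGL K r.

Lemma Fr_capP g u : Fr_cap (gl g) u <-> integral_mx (glV g *m map_mx (diag K) u).
Proof. exact: (hat_imageP (glK g) (glVK g)). Qed.

Lemma Fr_cap0 g : Fr_cap (gl g) 0.
Proof. by apply/Fr_capP; rewrite map_mx0 mulmx0 => i j; rewrite mxE; exact: integral0. Qed.

Lemma Fr_capD g u u' : Fr_cap (gl g) u -> Fr_cap (gl g) u' -> Fr_cap (gl g) (u + u').
Proof.
move=> /Fr_capP hu /Fr_capP hu'; apply/Fr_capP.
by rewrite map_mxD mulmxDr; exact: integral_addmx.
Qed.

Lemma Fr_capZ g a u : A a -> Fr_cap (gl g) u -> Fr_cap (gl g) (a *: u).
Proof.
move=> Aa /Fr_capP hu; apply/Fr_capP; rewrite map_diagZ -scalemxAr.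
by apply: integral_scalemx => //; exact/integral_diag.
Qed.

(** Elements of [J^-1] are those whose product with [x] is integral. Conversely
    elements of [J] bring the left side into [F^r cap g Ahat^r], and [J^-1 J]
    contains 1. *)
Lemma Fr_cap_mulV g (x : adele_unit K) :
  Fr_cap (gl (gl_mulV g x)) = msum *:%R (ideal_inv oo (idealJ x)) (Fr_cap (gl g)).
Proof.
have FrP u : Fr_cap (gl (gl_mulV g x)) u <->
    integral_mx (au x *: (glV g *m map_mx (diag K) u)).
  apply: iff_trans (Fr_capP _ _) _; rewrite /=.
  by rewrite mul_scalar_mx -scalemxAl.
rewrite eqEsubset; split=> u.
  move=> /FrP hu; rewrite -[u]scale1r.
  move: (fractional_invertible (idealJ_fractional x)); move: (1 : F).
  apply: msum_ind => [|a b ha hb|f j hf [y /Ahat_integral hy hj]].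
  - by rewrite scale0r; exact: msum0.
  - by rewrite scalerDl; exact: msumD.
  - rewrite -scalerA; apply: msum_in => //; apply/Fr_capP.
    rewrite map_diagZ -scalemxAr hj mulrC -scalerA; exact: integral_scalemx.
move: u; apply: msum_ind => [|u u'|f u /inv_idealJP hf /Fr_capP hu].
- exact: Fr_cap0.
- exact: Fr_capD.
- apply/FrP; rewrite map_diagZ -scalemxAr scalerA; exact: integral_scalemx.
Qed.

End FrCap.

(** * Modules over A as sums of ideals *)

(** Modules between two multiples of [A^n], described without generators. *)
Definition full_module n (M : set 'cV[F]_n) : Prop :=
  [/\ forall u u', M u -> M u' -> M (u + u'),
      forall a u, A a -> M u -> M (a *: u),
      exists2 d, d != 0 & forall u : 'cV[F]_n, (forall i, A (u i 0)) -> M (d *: u) &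
      exists2 c, c != 0 & forall u, M u -> forall i, A (c * u i 0)].

Lemma Fr_cap_full r (g : adeleGL K r) : full_module (Fr_cap (gl g)).
Proof.
split; [exact: Fr_capD|exact: Fr_capZ| |].
- have [d [Ad d0 hd]] := clear_denominators (glV_adelic g).
  exists d => // u Au; apply/Fr_capP; rewrite map_diagZ -scalemxAr scalemxAl.
  apply: integral_mulmx => //; apply: integral_map_diag => i j.
  by rewrite (ord1 j).
- have [c [Ac c0 hc]] := clear_denominators (gl_adelic g).
  exists c => // u /Fr_capP hu i.
  have : integral_mx (map_mx (diag K) (c *: u)).
    rewrite map_diagZ -[map_mx _ u]mul1mx -(glK g) -mulmxA scalemxAl.
    exact: integral_mulmx.
  by move=> /(_ i 0); rewrite !mxE => /integral_diag.
Qed.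

(** The columns of [E] are a basis of [F^n] in which [M] is the direct sum of the
    [I_j]. *)
Definition sum_of_ideals n (M : set 'cV[F]_n) : Prop :=
  exists (E : 'M[F]_n) (I : 'I_n -> set F),
    [/\ E \in unitmx, forall j, fractional_module (I j) &
        forall u, M (E *m u) <-> forall j, I j (u j 0)].

(** The first coordinates of [M] form an invertible ideal, so that the
    projection of [M] to them has a section [i |-> i *: e]. *)
Lemma split_first_coordinate n (M : set 'cV[F]_(1 + n)) :
  (forall M' : set 'cV[F]_n, full_module M' -> sum_of_ideals M') ->
  full_module M -> sum_of_ideals M.
Proof.
move=> IH [MD MZ [d d0 hd] [c c0 hc]].
have M0 : M 0.
  have -> : 0 = d *: (0 : 'cV[F]_(1 + n)) by rewrite scaler0.
  by apply: hd => i; rewrite mxE; exact: regular0.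
pose p := lshift n (0 : 'I_1).
pose I0 : set F := [set u p 0 | u in M].
have fracI0 : fractional_module I0.
  split.
  - by move=> _ _ [u Mu <-] [u' Mu' <-]; exists (u + u'); [exact: MD|rewrite mxE].
  - by move=> a _ Aa [u Mu <-]; exists (a *: u); [exact: MZ|rewrite mxE].
  - exists d => //; exists (d *: const_mx 1); last by rewrite !mxE mulr1.
    by apply: hd => i; rewrite mxE; exact: regular1.
  - by exists c => // _ [u Mu <-]; exact: hc.
have [e [ep eM]] : exists e : 'cV[F]_(1 + n), e p 0 = 1 /\
    forall i, I0 i -> M (i *: e).
  have hE : forall s, msum *%R (ideal_inv oo I0) I0 s -> exists e : 'cV[F]_(1 + n),
      e p 0 = s /\ forall i, I0 i -> M (i *: e).
    apply: msum_ind => [|s s' [e [<- he]] [e' [<- he']]|f _ hf [u Mu <-]].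
    - by exists 0; split=> [|i _]; rewrite ?mxE // scaler0.
    - exists (e + e'); split=> [|i Ii]; first by rewrite mxE.
      by rewrite scalerDr; apply: MD; [exact: he|exact: he'].
    - exists (f *: u); split=> [|i Ii]; first by rewrite mxE.
      by rewrite scalerA; apply: MZ => //; rewrite mulrC; exact: hf.
  exact/hE/fractional_invertible.
pose M' : set 'cV[F]_n := [set u | M (col_mx (0 : 'cV_1) u)].
have [|E' [I' [unitE' fracI' hE']]] := IH M'.
  split.
  - by move=> u u' hu hu'; rewrite /M' /= -[0]addr0 -add_col_mx; exact: MD.
  - by move=> a u Aa hu; rewrite /M' /= -(scaler0 _ a) -scale_col_mx; exact: MZ.
  - exists d => // u Au; rewrite /M' /= -(scaler0 _ d) -scale_col_mx.
    apply: hd => i; rewrite -(@splitK 1 n i); case: fintype.split => j /=.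
      by rewrite col_mxEu mxE; exact: regular0.
    by rewrite col_mxEd.
  - by exists c => // u /hc h i; have := h (rshift 1 i); rewrite col_mxEd.
exists (block_mx (1%:M : 'M_1) 0 (dsubmx e) E'),
  (fun j => match fintype.split j with inl _ => I0 | inr k => I' k end).
split.
- by rewrite unitmxE det_lblock det1 mul1r -unitmxE.
- by move=> j; case: fintype.split.
move=> u; rewrite -[u]vsubmxK mul_block_col mul1mx mul0mx addr0.
set u0 := usubmx u; set u' := dsubmx u.
have -> : dsubmx e *m u0 = u0 0 0 *: dsubmx e.
  by rewrite {1}(mx11_scalar u0) mul_mx_scalar.
have Ee : col_mx u0 (u0 0 0 *: dsubmx e + E' *m u') =
    u0 0 0 *: e + col_mx 0 (E' *m u').
  rewrite -[in RHS](vsubmxK e) scale_col_mx add_col_mx addr0; congr col_mx.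
  apply/matrixP => i j; rewrite (ord1 i) (ord1 j) [RHS]mxE [X in _ = _ * X]mxE.
  by rewrite -[lshift _ _]/p ep mulr1.
rewrite Ee; split=> [hM|hI].
  have Iu0 : I0 (u0 0 0).
    exists (u0 0 0 *: e + col_mx 0 (E' *m u')) => //.
    by rewrite mxE [(_ *: e) _ _]mxE ep mulr1 col_mxEu [(0 : 'cV_1) _ _]mxE addr0.
  have /hE' hu' : M' (E' *m u').
    rewrite /M' /=; have := MD _ _ hM (MZ (-1) _ _ (eM _ Iu0)).
    by rewrite scaleN1r addrAC subrr add0r; apply; apply: regularN; exact: regular1.
  move=> j; rewrite -(@splitK 1 n j) unsplitK; case: fintype.split => k /=.
    by rewrite col_mxEu (ord1 k).
  by rewrite col_mxEd.
apply: MD.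
  by apply: eM; have := hI p; rewrite (unsplitK (inl (0 : 'I_1))) col_mxEu.
apply/hE' => j; have := hI (rshift 1 j).
by rewrite (unsplitK (inr j)) col_mxEd.
Qed.

Lemma module_decomposition n (M : set 'cV[F]_n) : full_module M -> sum_of_ideals M.
Proof.
elim: n M => [|n IH] M; last exact: split_first_coordinate.
move=> [MD MZ [d d0 hd] [c c0 hc]].
exists 1%:M, (fun=> setT); split; [exact: unitmx1|by case|move=> u].
split=> [_ []//|_]; rewrite (_ : _ *m u = d *: u); last by apply/matrixP=> -[].
by apply: hd => -[].
Qed.

(** * The map Theta on double cosets *)

Section Theta.
Variable r : nat.
Implicit Types u : 'cV[F]_r.
Local Notation C := (cfield (Cinf K)).
Implicit Types (psi : 'rV[C]_r) (g k : adeleGL K r).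

Lemma psi_mapZ psi a u : psi_map psi (a *: u) = Cact a (psi_map psi u).
Proof. by rewrite /psi_map map_mxZ -scalemxAr mxE. Qed.

Lemma psi_mapD psi u u' : psi_map psi (u + u') = psi_map psi u + psi_map psi u'.
Proof. by rewrite /psi_map map_mxD mulmxDr mxE. Qed.

Lemma psi_map0 psi : psi_map psi 0 = 0.
Proof. by rewrite /psi_map map_mx0 mulmx0 mxE. Qed.

Lemma psi_mapM psi (f : 'M[F]_r) u :
  psi_map (psi *m map_mx (emb K) f) u = psi_map psi (f *m u).
Proof. by rewrite /psi_map map_mxM mulmxA. Qed.

Lemma psi_mapE psi (u : 'cV[F]_r) :
  psi_map psi u = \sum_j Cact (u j 0) (psi 0 j).
Proof. by rewrite /psi_map mxE; apply: eq_bigr => j _; rewrite mxE mulrC. Qed.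

Lemma psi_map_eq0 psi u : Psi psi -> psi_map psi u = 0 -> u = 0.
Proof.
rewrite psi_mapE => hpsi /(hpsi (fun j => cemb (loc K oo) (u j 0))) u0.
apply/matrixP => j i; rewrite (ord1 i) mxE; apply/eqP.
by rewrite -(fmorph_eq0 (cemb (loc K oo))) u0.
Qed.

Lemma psi_map_inj psi u u' : Psi psi -> psi_map psi u = psi_map psi u' -> u = u'.
Proof.
move=> hpsi e; apply/eqP; rewrite -subr_eq0; apply/eqP/(psi_map_eq0 hpsi).
by rewrite -scaleN1r psi_mapD psi_mapZ e -psi_mapZ -psi_mapD scaleN1r subrr psi_map0.
Qed.

(** A linear relation between the entries of [psi f] with coefficients [c] is one
    between those of [psi] with coefficients [f c]. *)
Lemma Psi_mulmx psi (f : 'M[F]_r) : f \in unitmx -> Psi psi ->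
  Psi (psi *m map_mx (emb K) f).
Proof.
move=> uf hpsi c hc; pose cv : 'cV[loc K oo]_r := \col_j c j.
have fc0 : map_mx (cemb (loc K oo)) f *m cv = 0.
  apply/matrixP => i j; rewrite (ord1 j) {j} [RHS]mxE.
  apply: (hpsi (fun i => (map_mx (cemb (loc K oo)) f *m cv) i 0)).
  rewrite -[RHS]hc; under [RHS]eq_bigr do rewrite mxE mulr_sumr.
  rewrite exchange_big; apply: eq_bigr => l _; rewrite mxE.
  rewrite (_ : emb_oo _ = \sum_j emb K (f l j) * emb_oo (c j)).
    rewrite mulr_suml; apply: eq_bigr => j _.
    by rewrite [map_mx _ _ _ _]mxE mulrAC mulrC [emb K _ * _]mulrC.
  rewrite /emb_oo !rmorph_sum; apply: eq_bigr => j _.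
  by rewrite !mxE !rmorphM.
have cv0 : cv = 0.
  have uf' : map_mx (cemb (loc K oo)) f \in unitmx by rewrite map_unitmx.
  by rewrite -(mulKmx uf' cv) fc0 mulmx0.
by move=> j; have /matrixP/(_ j 0) := cv0; rewrite !mxE.
Qed.

Section LevelStructures.
Variable N : set F.
Hypothesis hN : nonzero_ideal oo N.
Local Notation Ninv := (ideal_inv oo N).

(** An element of the kernel of [Ahat -> A/N] is a limit of elements of [N],
    which [N^-1] maps into [A]. *)
Lemma Ahat_ker_integral y f : Ahat_ker N y -> Ninv f -> integral (y * diag K f).
Proof.
move=> [a [Aa comp] [lim aN]] hf v; rewrite absvM diag_abs.
have [->|f0] := eqVneq f 0; first by rewrite absv0 mulr0.
have f_gt0 : 0 < nrm v f by exact: absv_gt0.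
have [I0 hI0 hlim] := lim v (nrm v f)^-1 (etrans (invr_gt0 _) f_gt0).
have [I0A I0D I0M [i0 Ii0 i00]] := hI0; have [NA ND NM [n0 Nn0 n00]] := hN.
have hI : nonzero_ideal oo (I0 `&` N).
  split=> [z [/I0A]//|z z' [? ?] [? ?]|z z' Az [? ?]|].
  - by split; [exact: I0D|exact: ND].
  - by split; [exact: I0M|exact: NM].
  - exists (i0 * n0); last exact: mulf_neq0.
    by split; [rewrite mulrC; apply: I0M => //; exact: NA|apply: NM => //; exact: I0A].
have Na : N (a (I0 `&` N)).
  by rewrite -(subrK (a N) (a _)); apply: ND => //; apply: comp => // z [].
have := hlim _ hI (@subIsetl _ _ _).
rewrite -[y v](subrK (diag K (a (I0 `&` N)) v)) => lt1.
rewrite -ler_pdivlMr // div1r; apply: absvD_le; first by rewrite subrK in lt1; exact: ltW.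
rewrite diag_abs -div1r ler_pdivlMr // -absvM mulrC.
by have /regularP := hf _ Na.
Qed.

Lemma KN_integral_mul k m (z : 'M[locprod K]_(r, m)) : KN N k ->
  integral_mx (glV k *m z) <-> integral_mx z.
Proof.
move=> [hk hkV _].
have ik : integral_mx (gl k) by move=> i j; apply/Ahat_integral.
have ikV : integral_mx (glV k) by move=> i j; apply/Ahat_integral.
split=> h; last exact: integral_mulmx.
by rewrite -[z]mul1mx -(glK k) -mulmxA; exact: integral_mulmx.
Qed.

Lemma KN_level k u : KN N k -> (forall j, Ninv (u j 0)) ->
  integral_mx ((gl k - 1%:M) *m map_mx (diag K) u).
Proof.
move=> [_ _ hk] hu i j; rewrite mxE; elim/big_ind: _ => [||l _].
- exact: integral0.
- exact: integralD.
- rewrite (ord1 j) [map_mx _ _ _ _]mxE; apply: Ahat_ker_integral (hu l).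
  by have := hk i l; rewrite !mxE.
Qed.

Lemma msum_mulmx (J : set F) (M M' : set 'cV[F]_r) (f : 'M[F]_r) :
  (forall u, M u -> M' (f *m u)) ->
  forall u, msum *:%R J M u -> msum *:%R J M' (f *m u).
Proof.
move=> MM'; apply: msum_ind => [|u u' hu hu'|a u Ja Mu].
- by rewrite mulmx0; exact: msum0.
- by rewrite mulmxDr; exact: msumD.
- by rewrite -scalemxAr; apply: msum_in => //; exact: MM'.
Qed.

(** Multiplication by [g^-1] turns the condition modulo [g Ahat^r] into one modulo
    [Ahat^r], which integral matrices preserve. *)
Lemma Theta_levP psi g X (z : C) : Theta_lev N psi (gl g) X z <->
  exists u, [/\ z = psi_map psi u, msum *:%R Ninv (Fr_cap (gl g)) u &
    exists2 b : 'cV[F]_r, forall j, X j (b j 0) &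
      integral_mx (glV g *m map_mx (diag K) u - map_mx (diag K) b)].
Proof.
have hatP (u b : 'cV[F]_r) : (exists2 y, vec_Ahat y &
    map_mx (diag K) u - gl g *m map_mx (diag K) b = gl g *m y) <->
    integral_mx (glV g *m map_mx (diag K) u - map_mx (diag K) b).
  apply: iff_trans (hat_imageP (glK g) (glVK g) _) _.
  by rewrite mulmxBr mulmxA glVK mul1mx.
split=> [[u [hu [b Xb /hatP h]] <-]|[u [-> hu [b Xb /hatP h]]]].
  by exists u; split=> //; exists b.
by exists u => //; split=> //; exists b.
Qed.

(** The left action of [f] is undone by the change of basis of [psi], and the
    right action of [k] preserves [Ahat^r] and is trivial on
    [N^-1 Ahat^r / Ahat^r]. *)
Section Invariance.
Variables s s' : Psi_GL K r.
Hypothesis ss' : dequiv N s s'.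

Lemma dequiv_data : exists (f : 'M[F]_r) k,
  [/\ f \in unitmx, KN N k,
      forall u, psi_map (sval s'.1) u = psi_map (sval s.1) (invmx f *m u),
      forall u, Fr_cap (gl s'.2) u <-> Fr_cap (gl s.2) (invmx f *m u) &
      glV s'.2 = glV k *m glV s.2 *m map_mx (diag K) (invmx f)].
Proof.
have [f [k [uf hk e1 e2]]] := ss'; exists f, k.
have eV : glV s'.2 = glV k *m glV s.2 *m map_mx (diag K) (invmx f).
  rewrite -[RHS]mul1mx -(glVK s'.2) e2 -!mulmxA [X in _ *m X](_ : _ = 1%:M).
    by rewrite mulmx1.
  rewrite (mulmxA (gl k)) glK mul1mx (mulmxA (gl s.2)) glK mul1mx -map_mxM.
  by rewrite mulmxV // map_mx1.
split=> // u; first by rewrite e1 psi_mapM.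
apply: iff_trans (Fr_capP _ _) _; apply: iff_trans (iff_sym (Fr_capP _ _)).
by rewrite eV map_mxM -!mulmxA; exact: KN_integral_mul.
Qed.

Lemma Theta_lat_invariant :
  Theta_lat (sval s'.1) (gl s'.2) = Theta_lat (sval s.1) (gl s.2).
Proof.
have [f [k [uf hk epsi eFr _]]] := dequiv_data.
rewrite eqEsubset; split=> _ [u Fu <-].
  by exists (invmx f *m u); [exact/eFr|rewrite epsi].
by exists (f *m u); [apply/eFr; rewrite mulKmx|rewrite epsi mulKmx].
Qed.

Lemma Theta_lev_invariant (X : 'I_r -> set F) : (forall j, X j `<=` Ninv) ->
  Theta_lev N (sval s'.1) (gl s'.2) X = Theta_lev N (sval s.1) (gl s.2) X.
Proof.
move=> XN; have [f [k [uf hk epsi eFr eV]]] := dequiv_data.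
have levE u (b : 'cV[F]_r) : (forall j, X j (b j 0)) ->
    integral_mx (glV s'.2 *m map_mx (diag K) u - map_mx (diag K) b) <->
    integral_mx (glV s.2 *m map_mx (diag K) (invmx f *m u) - map_mx (diag K) b).
  move=> Xb; rewrite eV -!mulmxA -map_mxM.
  set z := glV s.2 *m _; set b' := map_mx _ b.
  have -> : glV k *m z - b' = glV k *m (z - b' - (gl k - 1%:M) *m b').
    rewrite mulmxBl mul1mx opprB addrA subrK mulmxBr mulmxA glVK mul1mx //.
  apply: iff_trans (KN_integral_mul _ hk) _; apply: integral_subr.
  by apply: KN_level => // j; exact: XN.
apply/seteqP; split=> z /Theta_levP[u [-> hu [b Xb hb]]]; apply/Theta_levP.
  exists (invmx f *m u); split; first by rewrite epsi.
    by apply: msum_mulmx hu => u' /eFr.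
  by exists b => //; exact/levE.
exists (f *m u); split; first by rewrite epsi mulKmx.
  by apply: msum_mulmx hu => u' Fu'; apply/eFr; rewrite mulKmx.
by exists b => //; apply/levE => //; rewrite mulKmx.
Qed.

End Invariance.

(** * The action of ideles in coordinates *)

Definition gl_one : adeleGL K r.
Proof.
apply: (@AdeleGL _ _ _ K r 1%:M 1%:M); rewrite ?mulmx1 // => i j.
all: by rewrite -(map_mx1 (diag K)); exact: adelic_map_diag.
Defined.

Lemma KN_one : KN N gl_one.
Proof.
have int1 i j : integral ((1%:M : 'M[locprod K]_r) i j).
  rewrite -(map_mx1 (diag K)); apply: integral_map_diag => l m.
  by rewrite mxE; case: eqP => _; [exact: regular1|exact: regular0].
split=> i j; try exact/Ahat_integral/int1.
rewrite subrr; exists (fun=> 0).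
  split=> [I _|I I' _ [_ _ IM [a Ia _]] _]; first exact: regular0.
  by rewrite subrr -(mul0r a); apply: IM => //; exact: regular0.
split=> [v e e0|].
  by exists N => // I _ _; rewrite rmorph0 subrr absv0.
by have [_ _ NM [a Na _]] := hN; rewrite -(mul0r a); apply: NM => //; exact: regular0.
Qed.

Definition gl_lmul (f : 'M[F]_r) (uf : f \in unitmx) g : adeleGL K r.
Proof.
apply: (@AdeleGL _ _ _ K r (map_mx (diag K) f *m gl g)
                           (glV g *m map_mx (diag K) (invmx f))).
- by rewrite mulmxA -(mulmxA _ (gl g)) glK mulmx1 -map_mxM mulmxV // map_mx1.
- by rewrite -mulmxA (mulmxA (map_mx _ _)) -map_mxM mulVmx // map_mx1 mul1mx glVK.
- by apply: adelic_mulmx; [exact: adelic_map_diag|exact: gl_adelic].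
- by apply: adelic_mulmx; [exact: glV_adelic|exact: adelic_map_diag].
Defined.

Lemma dequiv_lmul (f : 'M[F]_r) (uf : f \in unitmx) (s s' : Psi_GL K r) :
  sval s'.1 = sval s.1 *m map_mx (emb K) (invmx f) ->
  gl s'.2 = map_mx (diag K) f *m gl s.2 -> dequiv N s s'.
Proof.
by move=> e1 e2; exists f, gl_one; split=> //; [exact: KN_one|rewrite e2 mulmx1].
Qed.

Lemma dequiv_refl (s : Psi_GL K r) : dequiv N s s.
Proof.
by apply: (dequiv_lmul (unitmx1 F r)); rewrite ?invmx1 map_mx1 ?mulmx1 ?mul1mx.
Qed.

Lemma regular_sub_inv : A `<=` Ninv.
Proof. by have [NA _ _ _] := hN => a Aa n /NA; exact: regularM. Qed.

Lemma subquot_sub (X : subquot Ninv A) : sval X `<=` Ninv.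
Proof.
case: X => _ /= [a Na ->] _ [b Ab <-] n Nn; rewrite mulrDl.
by apply: regularD; [exact: Na|exact: regular_sub_inv].
Qed.

Lemma Theta_representative (s : Psi_GL K r) (L : level_lattice K N r) :
  Theta (dclass N s) L ->
  lat L = Theta_lat (sval s.1) (gl s.2) /\
  forall X, sval (lev L X) =
            Theta_lev N (sval s.1) (gl s.2) (fun j => sval (X j)).
Proof.
move=> [s0 [es latL levL]].
have ss0 : dequiv N s0 s by have : dclass N s s by [exact: dequiv_refl]; rewrite es.
split=> [|X]; first by rewrite latL (Theta_lat_invariant ss0).
rewrite levL (Theta_lev_invariant ss0) // => j; exact: subquot_sub.
Qed.

Lemma Theta_lat_mulV psi g (x : adele_unit K) :
  Theta_lat psi (gl (gl_mulV g x)) =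
  msum (@Cact _ _ _ K) (ideal_inv oo (idealJ x)) (Theta_lat psi (gl g)).
Proof.
rewrite /Theta_lat Fr_cap_mulV eqEsubset; split=> z.
  move=> [u + <-]; move: u; apply: msum_ind => [|u u' hu hu'|a u Ja Fu].
  - by rewrite psi_map0; exact: msum0.
  - by rewrite psi_mapD; exact: msumD.
  - by rewrite psi_mapZ; apply: msum_in => //; exists u.
move: z; apply: msum_ind => [|_ _ [u hu <-] [u' hu' <-]|a _ Ja [u Fu <-]].
- by exists 0; [exact: msum0|exact: psi_map0].
- by exists (u + u'); [exact: msumD|exact: psi_mapD].
- by exists (a *: u); [exact: msum_in|exact: psi_mapZ].
Qed.

Lemma presentation_exists psi g : Psi psi ->
  exists (I : 'I_r -> set F) (phi : 'rV[C]_r),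
    presentation (Theta_lat psi (gl g)) I phi.
Proof.
move=> hpsi; have [E [I [uE fracI EI]]] := module_decomposition (Fr_cap_full g).
exists I, (psi *m map_mx (emb K) E); split.
- by move=> j; exact: fractional_moduleP.
- exact: Psi_mulmx.
rewrite eqEsubset; split=> z.
  move=> [u Fu <-]; exists (fun j => (invmx E *m u) j 0).
    by apply/EI; rewrite mulKVmx.
  by rewrite -psi_mapE psi_mapM mulKVmx.
move=> [c Ic ->]; exists (E *m \col_j c j).
  by apply/EI => j; rewrite mxE.
by rewrite -psi_mapM psi_mapE; apply: eq_bigr => j _; rewrite mxE.
Qed.

(** A nonzero [i] in [I_j] gives [i phi_j] in the lattice, so that [phi_j] is in
    the [F]-span of [psi]. The matrix is invertible as [phi] is linearly
    independent. *)
Lemma presentation_basis psi g I phi : Psi psi ->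
  presentation (Theta_lat psi (gl g)) I phi ->
  exists2 E : 'M[F]_r, E \in unitmx & phi = psi *m map_mx (emb K) E.
Proof.
move=> hpsi [fracI hphi latE].
have I0 j : I j 0.
  have [[n [e ->]] _] := fracI j; exists (fun=> 0); first by move=> _; exact: regular0.
  by rewrite big1 // => i _; rewrite mul0r.
have /choice [e he] : forall j, exists e, phi 0 j = psi_map psi e.
  move=> j; have [_ [i Ii i0]] := fracI j.
  have : Theta_lat psi (gl g) (Cact i (phi 0 j)).
    rewrite latE; exists (fun l => if l == j then i else 0).
      by move=> l; case: eqP => [->|].
    rewrite (bigD1 j) //= eqxx big1 ?addr0 // => l /negPf ->.
    by rewrite /Cact rmorph0 mul0r.
  move=> [u _ eu]; exists (i^-1 *: u); rewrite psi_mapZ eu /Cact mulrA -rmorphM.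
  by rewrite mulVf // rmorph1 mul1r.
pose E : 'M[F]_r := \matrix_(i, j) e j i 0.
have phiE : phi = psi *m map_mx (emb K) E.
  apply/rowP => j; rewrite he /psi_map !mxE; apply: eq_bigr => i _.
  by rewrite !mxE.
exists E => //; rewrite unitmxE unitfE -det_tr; apply/det0P => -[c c0 cE].
case/eqP: c0; apply: trmx_inj; rewrite trmx0; apply: (psi_map_eq0 hphi).
rewrite phiE psi_mapM -[E *m _]trmxK trmx_mul trmxK cE trmx0; exact: psi_map0.
Qed.

(** Density gives [u]. Multiplied by an element of [N], which makes [b] integral,
    it falls in [F^r cap g Ahat^r], and [N^-1 N] contains 1. *)
Lemma lift_level g (b : 'cV[F]_r) : (forall j, Ninv (b j 0)) -> exists2 u,
  msum *:%R Ninv (Fr_cap (gl g)) u &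
  integral_mx (glV g *m map_mx (diag K) u - map_mx (diag K) b).
Proof.
move=> Nb; have [d [Ad d0 hd]] := clear_denominators (glV_adelic g).
have [|u [y [hy zu]]] := @adelic_approximation _ (gl g *m map_mx (diag K) b) d _ Ad d0.
  by apply: adelic_mulmx; [exact: gl_adelic|exact: adelic_map_diag].
have hu : integral_mx (glV g *m map_mx (diag K) u - map_mx (diag K) b).
  have -> : glV g *m map_mx (diag K) u - map_mx (diag K) b =
            - ((diag K d *: glV g) *m y).
    rewrite -scalemxAl scalemxAr -zu mulmxBr mulmxA glVK mul1mx opprB //.
  by apply: integral_oppmx; exact: integral_mulmx.
exists u => //; rewrite -[u]scale1r.
move: (fractional_invertible (nonzero_ideal_fractional hN)); move: (1 : F).
apply: msum_ind => [|a a' ha ha'|f n Nf Nn].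
- by rewrite scale0r; exact: msum0.
- by rewrite scalerDl; exact: msumD.
rewrite -scalerA; apply: msum_in => //; apply/Fr_capP.
have NA : A n by have [NA _ _ _] := hN; exact: NA.
apply/(@integral_subr _ _ _ (map_mx (diag K) (n *: b))).
  apply: integral_map_diag => i j; rewrite (ord1 j) mxE mulrC; exact: Nb.
rewrite !map_diagZ -scalemxAr -scalerBr.
by apply: integral_scalemx => //; exact/integral_diag.
Qed.

Section Coordinates.
Variables (g : adeleGL K r) (I : 'I_r -> set F).
Hypothesis gI : forall u, Fr_cap (gl g) u <-> forall j, I j (u j 0).

Lemma coordinate_in j i : I j i -> Fr_cap (gl g) (i *: delta_mx j 0).
Proof.
move=> Ii; apply/gI => l; rewrite !mxE eqxx andbT.
have [->|_] := eqVneq l j; first by rewrite mulr1.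
by rewrite mulr0; have /gI/(_ l) := Fr_cap0 g; rewrite mxE.
Qed.

(** Density gives [g Ahat^r = (F^r cap g Ahat^r) Ahat], the direct sum of the
    [I_j Ahat]. *)
Lemma hat_coordinates (z : 'cV[locprod K]_r) : integral_mx (glV g *m z) <->
  forall j, msum (@diag_act _ _ _ K) (I j) (@Ahat _ _ _ K) (z j 0).
Proof.
split=> [hz j|hz].
  have [d [Ad d0 hd]] := clear_denominators (glV_adelic g).
  have zad i l : adelic (z i l).
    rewrite -[z]mul1mx -(glK g) -mulmxA; apply: adelic_mulmx; first exact: gl_adelic.
    by move=> ? ?; exact/integral_adelic/hz.
  have [u [y [hy zu]]] := adelic_approximation zad Ad d0.
  have zE : z = map_mx (diag K) u + diag K d *: y by rewrite -zu addrC subrK.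
  have hdy : integral_mx (glV g *m (diag K d *: y)).
    by rewrite -scalemxAr scalemxAl; exact: integral_mulmx.
  rewrite zE !mxE; apply: msumD.
    have -> : diag K (u j 0) = diag_act (u j 0) (1 : locprod K).
      by rewrite /diag_act mulr1.
    apply: msum_in.
      move: j; apply/gI/Fr_capP.
      have -> : glV g *m map_mx (diag K) u = glV g *m z - glV g *m (diag K d *: y).
        by rewrite -mulmxBr zE addrK.
      by apply: integral_addmx => //; exact: integral_oppmx.
    by apply/Ahat_integral => v; rewrite absv1.
  apply: msum_in; last exact/Ahat_integral.
  have : Fr_cap (gl g) (d *: delta_mx j 0).
    apply/Fr_capP; rewrite map_diagZ -scalemxAr scalemxAl; apply: integral_mulmx => //.
    apply: integral_map_diag => i l; rewrite mxE.
    by case: (_ && _); [exact: regular1|exact: regular0].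
  by move=> /gI/(_ j); rewrite !mxE !eqxx mulr1.
have -> : z = \sum_j z j 0 *: delta_mx j 0.
  by rewrite [LHS]matrix_sum_delta; apply: eq_bigr => j _; rewrite big_ord1.
rewrite mulmx_sumr => i l; rewrite summxE; elim/big_ind: _ => [||j _].
- exact: integral0.
- exact: integralD.
move: i l; rewrite -/(integral_mx _).
move: (z j 0) (hz j); apply: msum_ind => [|y y' hy hy'|a y Ia /Ahat_integral hy].
- by rewrite scale0r mulmx0 => ? ?; rewrite mxE; exact: integral0.
- by rewrite scalerDl mulmxDr; exact: integral_addmx.
rewrite /diag_act mulrC -scalerA -scalemxAr; apply: integral_scalemx => //.
have /Fr_capP := coordinate_in Ia; rewrite map_diagZ.
suff -> : map_mx (diag K) (delta_mx j 0 : 'cV[F]_r) = delta_mx j 0 by [].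
exact: map_delta_mx.
Qed.

(** Both sides impose on an element of [N^-1 J^-1 Lambda] with coordinates [w]
    that [x w] be congruent modulo [g Ahat^r] to [g b] for some [b] in the given
    cosets. The right side passes through an intermediate [u] in [N^-1 Lambda]
    congruent to [g b], supplied by [lift_level]. *)
Lemma level_coordinates psi (x : adele_unit K) (X : 'I_r -> set F) : Psi psi ->
  (forall j, X j `<=` Ninv) ->
  Theta_lev N psi (gl (gl_mulV g x)) X =
  xinv_lattice N x I psi (Theta_lev N psi (gl g) X).
Proof.
move=> hpsi XN.
have xE (u b : 'cV[F]_r) : glV (gl_mulV g x) *m map_mx (diag K) u - map_mx (diag K) b =
    glV g *m (au x *: map_mx (diag K) u) - map_mx (diag K) b.
  by rewrite /= mul_scalar_mx -scalemxAl scalemxAr.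
have xinvE i (X' : set F) c : xinv_ideal N x (I i) X' c <->
    msum *%R Ninv (msum *%R (ideal_inv oo (idealJ x)) (I i)) c /\
    exists2 c', X' c' & msum (@diag_act _ _ _ K) (I i) (@Ahat _ _ _ K)
                         (au x * diag K c - diag K c').
  have xK y : au x * (auV x * y) = y by rewrite mulrA auK mul1r.
  have xVK y : auV x * (au x * y) = y by rewrite mulrA auVK mul1r.
  split=> -[hc [c' Xc' hc']]; split=> //; exists c' => //.
    by case: hc' => y hy e; rewrite -[diag K c'](xK) -mulrBr e xK.
  by exists (au x * diag K c - diag K c') => //; rewrite mulrBr xVK.
apply/seteqP; split=> z.
  move=> /Theta_levP[w [-> hw [b Xb]]]; rewrite xE => hb.
  have [u hu hub] := lift_level g (fun j => XN j _ (Xb j)).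
  exists (fun j => u j 0), (fun j => w j 0); split.
  - move=> j; move: u hu {hub}; apply: msum_ind => [|u u' hu hu'|a u Na /gI Iu].
    + by rewrite mxE; exact: msum0.
    + by rewrite mxE; exact: msumD.
    + by rewrite mxE; exact: msum_in.
  - by apply/Theta_levP; exists u; split=> //; [rewrite psi_mapE|exists b].
  - move=> j; apply/xinvE; split.
      move: w hw {hb}; rewrite Fr_cap_mulV.
      apply: msum_ind => [|w w' hw hw'|a w Na hw].
      + by rewrite mxE; exact: msum0.
      + by rewrite mxE; exact: msumD.
      rewrite mxE; apply: msum_in => //.
      move: w hw; apply: msum_ind => [|w w' hw hw'|a' w Ja' /gI Iw].
      + by rewrite mxE; exact: msum0.
      + by rewrite mxE; exact: msumD.
      + by rewrite mxE; exact: msum_in.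
    exists (u j 0).
      exists 0; last by rewrite addr0.
      by have /gI/(_ j) := Fr_cap0 g; rewrite mxE.
    have : integral_mx (glV g *m (au x *: map_mx (diag K) w - map_mx (diag K) u)).
      have -> : glV g *m (au x *: map_mx (diag K) w - map_mx (diag K) u) =
          (glV g *m (au x *: map_mx (diag K) w) - map_mx (diag K) b) +
          - (glV g *m map_mx (diag K) u - map_mx (diag K) b).
        by rewrite mulmxBr opprB addrA subrK.
      by apply: integral_addmx => //; exact: integral_oppmx.
    by move=> /hat_coordinates/(_ j); rewrite !mxE.
  - by rewrite psi_mapE.
move=> [u [w [hu /Theta_levP[u' [eu hu' [b Xb hb]]] hw ->]]].
have uE j : u j = u' j 0.
  suff -> : u' = \col_j u j by rewrite mxE.
  apply: (psi_map_inj hpsi); rewrite -eu psi_mapE.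
  by apply: eq_bigr => i _; rewrite mxE.
pose wv : 'cV[F]_r := \col_j w j.
apply/Theta_levP; exists wv; split.
- by rewrite psi_mapE; apply: eq_bigr => j _; rewrite mxE.
- have -> : wv = \sum_j w j *: delta_mx j 0.
    rewrite [LHS]matrix_sum_delta; apply: eq_bigr => j _.
    by rewrite big_ord1 mxE.
  elim/big_ind: _ => [||j _]; [exact: msum0|exact: msumD|].
  rewrite Fr_cap_mulV; have [+ _] := hw j; move: (w j).
  apply: msum_ind => [|c c' hc hc'|n m Nn hm].
  + by rewrite scale0r; exact: msum0.
  + by rewrite scalerDl; exact: msumD.
  rewrite -scalerA; apply: msum_in => //; move: m hm.
  apply: msum_ind => [|c c' hc hc'|a i Ja Ii].
  + by rewrite scale0r; exact: msum0.
  + by rewrite scalerDl; exact: msumD.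
  + by rewrite -scalerA; apply: msum_in => //; exact: coordinate_in.
exists b => //; rewrite xE.
have -> : glV g *m (au x *: map_mx (diag K) wv) - map_mx (diag K) b =
    glV g *m (au x *: map_mx (diag K) wv - map_mx (diag K) u') +
    (glV g *m map_mx (diag K) u' - map_mx (diag K) b).
  by rewrite mulmxBr addrA subrK.
apply: integral_addmx => //; apply/hat_coordinates => j.
have /xinvE[_ [_ [i Ii <-] hi]] := hw j.
rewrite !mxE -uE (_ : _ - _ = (au x * diag K (w j) - diag K (u j + i)) + diag K i * 1).
  apply: msumD => //; apply: msum_in => //.
  by apply/Ahat_integral => v; rewrite absv1.
by rewrite mulr1 rmorphD opprD addrA subrK.
Qed.

End Coordinates.

(** Representatives can be chosen freely in a class, so that a presentation by
    [phi = psi E] may be assumed to come from the representative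
    [(phi, E^-1 g)]. *)
Theorem level_action (x : adele_unit K) (L L' : level_lattice K N r) :
  adele_act x L L' ->
  [/\ lat L' = msum (@Cact _ _ _ K) (ideal_inv oo (idealJ x)) (lat L),
      exists (I : 'I_r -> set F) (psi : 'rV[Cinf K]_r),
        presentation (lat L) I psi &
      forall (I : 'I_r -> set F) (psi : 'rV[Cinf K]_r),
        presentation (lat L) I psi ->
        forall X : 'I_r -> subquot (ideal_inv oo N) (regular_ring oo),
          sval (lev L' X) = xinv_lattice N x I psi (sval (lev L X))].
Proof.
move=> [s [sL sL']].
have [latL levL] := Theta_representative sL.
have [latL' levL'] := Theta_representative sL'.
have hpsi : Psi (sval s.1) := svalP s.1.
split; first by rewrite latL' latL /= Theta_lat_mulV.
  by rewrite latL; exact: presentation_exists.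
move=> I phi + X; rewrite {1}latL => hphi.
have [E uE phiE] := presentation_basis hpsi hphi.
have [_ Pphi latphi] := hphi.
have uEV : invmx E \in unitmx by rewrite unitmx_inv.
pose s' : Psi_GL K r := (exist _ phi Pphi, gl_lmul uEV s.2).
have ss' : dequiv N s s' by apply: (dequiv_lmul uEV); rewrite //= invmxK.
have ssx : dequiv N (s.1, gl_mulV s.2 x) (s'.1, gl_mulV s'.2 x).
  by apply: (dequiv_lmul uEV); rewrite /= ?invmxK // mulmxA.
have XN j : sval (X j) `<=` Ninv by exact: subquot_sub.
rewrite levL' levL -(Theta_lev_invariant ssx) // -(Theta_lev_invariant ss') //.
apply: (@level_coordinates (gl_lmul uEV s.2) I _ phi) => // u.
have Fu : Fr_cap (gl (gl_lmul uEV s.2)) u <->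
    Theta_lat phi (gl (gl_lmul uEV s.2)) (psi_map phi u).
  by split=> [h|[u' Fu' /(psi_map_inj Pphi)<-]]; first by exists u.
have latE : Theta_lat phi (gl (gl_lmul uEV s.2)) = Theta_lat (sval s.1) (gl s.2).
  exact: (Theta_lat_invariant ss').
apply: iff_trans Fu _; rewrite latE latphi; split=> [[c Ic e] j|Iu].
  suff -> : u = \col_l c l by rewrite mxE.
  by apply: (psi_map_inj Pphi); rewrite e psi_mapE; apply: eq_bigr => l _; rewrite mxE.
by exists (fun j => u j 0); rewrite -?psi_mapE.
Qed.

End LevelStructures.
End Theta.
End Completions.
End NonUnit.
End RegularRing.

Theorem proposition50
    (R : realType) (p : nat) (hp : prime p)
    (F : fieldExtType {fraction {poly 'F_p}}) (oo : place F)
    (K : completions R oo)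
    (r : nat) (hr : (1 <= r)%N)
    (N : set F) (hN : nonzero_ideal oo N) (hNproper : N <> regular_ring oo)
    (x : adele_unit K) (L L' : level_lattice K N r)
    (hLL' : adele_act x L L') :
  [/\ lat L' = msum (@Cact _ _ _ K) (ideal_inv oo (idealJ x)) (lat L),
      exists (I : 'I_r -> set F) (psi : 'rV[Cinf K]_r),
        presentation (lat L) I psi &
      forall (I : 'I_r -> set F) (psi : 'rV[Cinf K]_r),
        presentation (lat L) I psi ->
        forall X : 'I_r -> subquot (ideal_inv oo N) (regular_ring oo),
          sval (lev L' X) = xinv_lattice N x I psi (sval (lev L X))].
Proof.
have [NA _ NM [n Nn n0]] := hN.
(* A unit in [N] would make it the whole ring. *)
have nVA : ~ regular_ring oo n^-1.
  move=> AnV; apply: hNproper; rewrite eqEsubset; split=> // a Aa.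
  by rewrite -(divfK n0 a); apply: NM => //; exact: regularM.
exact: (level_action (@fieldExt_digit_collision p F) (NA _ Nn) nVA hN hLL').
Qed.
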